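(* Let $\Sigma$ be a topological graph in $\mathbb{R}^2$ with smooth edges, let $\phi$ be a level set function of $\Sigma$, i.e. $\Sigma=\{\mathbf{x}\in\mathbb{R}^2:\phi(\mathbf{x})=0\}$, with $|\nabla\phi|\neq0$ along $\Sigma$, and let $\tilde\rho$ be the signed distance function to $\Sigma$, i.e. the distance to $\Sigma$ given the same sign as $\phi$. Then $$\delta_\Sigma(\mathbf{x})=\delta(\tilde\rho)=\delta(\phi)\,|\nabla\phi|,$$ that is, for every $f\in C_c^\infty(\mathbb{R}^2)$, $$\int_{\mathbb{R}^2}f(\mathbf{x})\,\delta(\tilde\rho)\,d\mathbf{x}=\int_{\mathbb{R}^2}f(\mathbf{x})\,\delta(\phi)\,|\nabla\phi|\,d\mathbf{x}=\int_\Sigma f(\mathbf{x}(s))\,ds .$$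
   Context: Topological graph with smooth edges: a closed subset $\Sigma\subset\mathbb{R}^2$ that is a union of finitely or countably many vertices and edges. Each edge is a smooth regular curve, smooth up to its endpoints (if any), the endpoints being vertices and the interior being simple; closed smooth loops without vertices and edges of infinite length are allowed. Interiors of distinct edges are disjoint from each other and from the vertices, there are finitely many edges between any two vertices, and every compact subset of $\mathbb{R}^2$ meets only finitely many edges and vertices. $P_\Sigma$ is the set of points of $\Sigma$ near which $\Sigma$ is not a one-dimensional smooth embedded submanifold without boundary. $\int_\Sigma\,\cdot\,ds$ is the arc length integral over all edges, and $\delta_\Sigma$ is the distribution with $\int_{\mathbb{R}^2}\delta_\Sigma f\,d\mathbf{x}=\int_\Sigma f(\mathbf{x}(s))\,ds$ for $f\in C_c^\infty(\mathbb{R}^2)$. The function $\phi$ is real-valued on $\mathbb{R}^2$, smooth near each point of $\Sigma\setminus P_\Sigma$, and $\nabla\phi\ne0$ at each such point. The signed distance is $\tilde\rho(\mathbf{x})=\operatorname{sgn}(\phi(\mathbf{x}))\inf_{\mathbf{y}\in\Sigma}|\mathbf{x}-\mathbf{y}|$. Convention: here $\int_{-\infty}^{\infty}\delta(t)g(t)\,dt=g(0)$. Meaning of the integrals: for a compact arc $\Sigma_i=\{\mathbf{x}(s):s\in[a_i,b_i]\}\subset\Sigma\setminus P_\Sigma$ parametrized by arc length, let $n(s)$ be the unit normal to $\Sigma$ pointing to the side $\phi>0$. For small $\epsilon_i>0$, $(\tilde\rho,s)\mapsto\mathbf{x}(s)+\tilde\rho\,n(s)$, $|\tilde\rho|<\epsilon_i$,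 $s\in[a_i,b_i]$, are coordinates near $\Sigma_i$ in which the first coordinate is the signed distance and $\frac{\partial\phi}{\partial\tilde\rho}>0$, so that $(\phi,s)$ are also coordinates, with $d\tilde\rho\,ds=\frac{1}{\partial\phi/\partial\tilde\rho}\,d\phi\,ds$; let $J_i$ be the absolute Jacobian determinant of $(x,y)$ with respect to $(\tilde\rho,s)$. Let $U_\epsilon$, for small $\epsilon>0$, be a union of pairwise disjoint bounded open neighbourhoods, one around each point of $P_\Sigma$, contained in the $\epsilon$-neighbourhood of $P_\Sigma$, whose boundary is near each point of $\Sigma\cap\partial U_\epsilon$ a smooth curve perpendicular to $\Sigma$ there, and let $\chi_\epsilon$ be the characteristic function of $\mathbb{R}^2\setminus U_\epsilon$. For each $\epsilon$ take finitely many compact arcs $\Sigma_i=\{\mathbf{x}(s):s\in[a_i,b_i]\}\subset\Sigma\setminus P_\Sigma$, each parametrized by arc length and equipped with the coordinates $(\tilde\rho,s)$, $|\tilde\rho|<\epsilon_i$, and the corresponding Jacobian $J_i$, and $h_i\in C_c^\infty(\mathbb{R}^2)$ with $\operatorname{supp}h_i\cap\Sigma\subset\Sigma_i$ and $\sum_ih_i=1$ on a neighbourhood of $(\Sigma\setminus U_\epsilon)\cap\operatorname{supp}f$. Then $$\int_{\mathbb{R}^2}f\,\delta(\tilde\rho)\,d\mathbf{x}:=\lim_{\epsilon\to0}\sum_i\int_{a_i}^{b_i}\left[\int\delta(\tilde\rho)\,\chi_\epsilon f h_i\,J_i\,d\tilde\rho\right]ds,$$ $$\int_{\mathbb{R}^2}f\,\delta(\phi)|\nabla\phi|\,d\mathbf{x}:=\lim_{\epsilon\to0}\sum_i\int_{a_i}^{b_i}\left[\int\delta(\phi)\,\chi_\epsilon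 f h_i\,|\nabla\phi|\,J_i\,\frac{1}{\partial\phi/\partial\tilde\rho}\,d\phi\right]ds,$$ the inner integrals being the values of the rest of the integrand at $\tilde\rho=0$, respectively $\phi=0$ (for all $s$ except the finitely many with $\mathbf{x}(s)\in\partial U_\epsilon$). The asserted identities (including existence of the limits) hold for all such choices. *)

(* Defs.v *)
From HB Require Import structures.
From mathcomp Require Import all_boot all_order all_algebra.
From mathcomp Require Import all_classical all_reals all_analysis.

Set Implicit Arguments.
Unset Strict Implicit.
Unset Printing Implicit Defensive.
Import Order.TTheory GRing.Theory Num.Theory.
Import numFieldNormedType.Exports.

Local Open Scope classical_set_scope.
Local Open Scope ring_scope.

(* The library norm on [R * R] is the sup norm; it is only used through the
   topology it induces, lengths and distances being taken with [enorm]. *)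
Notation plane R := (R * R)%type.

Definition dotp (R : realType) (v w : plane R) : R := v.1 * w.1 + v.2 * w.2.

Definition enorm (R : realType) (v : plane R) : R := Num.sqrt (dotp v v).

Definition partial (R : realType) (i : bool) (f : plane R -> R) : plane R -> R :=
  fun p => 'D_((if i then (0, 1) else (1, 0)) : plane R) f p.

Definition grad (R : realType) (f : plane R -> R) (p : plane R) : plane R :=
  (partial false f p, partial true f p).

(* C^oo on a neighbourhood of [p]: every iterated partial derivative exists and
   is (Frechet) differentiable there. *)
Definition smooth_near (R : realType) (f : plane R -> R) (p : plane R) : Prop :=
  \forall q \near p, forall w : seq bool,
    differentiable (foldr (@partial R) f w) q.

Definition smooth_map_near (R : realType) (F : plane R -> plane R)
    (p : plane R) : Prop :=
  smooth_near (fun q => (F q).1) p /\ smooth_near (fun q => (F q).2) p.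

Definition smooth_curve_near (R : realType) (c : R -> plane R) (t : R) : Prop :=
  \forall u \near t, forall n : nat, derivable (derive1n n c) u 1.

Definition tsupp (R : realType) (f : plane R -> R) : set (plane R) :=
  closure [set p | f p != 0].

Definition test_function (R : realType) (f : plane R -> R) : Prop :=
  (forall p, smooth_near f p) /\ compact (tsupp f).

(* [S] is, near [p], a one-dimensional embedded submanifold without boundary:
   slice-chart definition. *)
Definition embedded_curve_near (R : realType) (S : set (plane R))
    (p : plane R) : Prop :=
  exists (W W' : set (plane R)) (F F' : plane R -> plane R),
    [/\ open W, W p & open W'] /\
    [/\ forall q, W q -> W' (F q) /\ F' (F q) = q,
        forall q, W' q -> W (F' q) /\ F (F' q) = q,
        forall q, W q -> smooth_map_near F q,
        forall q, W' q -> smooth_map_near F' q &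
        forall q, W q -> (S q <-> (F q).2 = 0)].

Definition tangent_vector (R : realType) (S : set (plane R))
    (p v : plane R) : Prop :=
  exists c : R -> plane R,
    [/\ smooth_curve_near c 0, c 0 = p, \forall t \near (0 : R), S (c t) &
        derive1 c 0 = v].

(* Edges are parametrized by arc length, up to translation and reversal of the
   parameter: [0, l] for an edge of length l between two vertices, [0, +oo[
   (resp. the whole line) for an edge of infinite length with one endpoint
   (resp. none), and [0, l[ for a loop without vertex, which is given by an
   l-periodic function on the line. *)
Inductive edge_shape (R : realType) : Type :=
  | Segment of R
  | Ray
  | Line
  | Loop of R.

Arguments Ray {R}.
Arguments Line {R}.

Record edge (R : realType) : Type :=
  Edge { eshape : edge_shape R; epath : R -> plane R }.

Definition edom (R : realType) (e : edge R) : set R :=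
  match eshape e with
  | Segment l => `[0, l]
  | Ray => `[0, +oo[
  | Line => setT
  | Loop l => `[0, l[
  end.

Definition edom_interior (R : realType) (e : edge R) : set R :=
  match eshape e with
  | Segment l => `]0, l[
  | Ray => `]0, +oo[
  | Line => setT
  | Loop l => `[0, l[
  end.

Definition epoints (R : realType) (e : edge R) : set (plane R) :=
  epath e @` edom e.

Definition einterior (R : realType) (e : edge R) : set (plane R) :=
  epath e @` edom_interior e.

Definition eendpoints (R : realType) (e : edge R) : set (plane R) :=
  match eshape e with
  | Segment l => [set epath e 0; epath e l]
  | Ray => [set epath e 0]
  | Line => set0
  | Loop _ => set0
  end.

Definition joins (R : realType) (e : edge R) (v w : plane R) : Prop :=
  match eshape e with
  | Segment l => [set epath e 0; epath e l] = [set v; w]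
  | _ => False
  end.

(* [epath e] is a function on the whole line, but only its values on [edom e]
   matter; smoothness near the points of [edom e] is smoothness up to the
   endpoints. *)
Definition smooth_edge (R : realType) (e : edge R) : Prop :=
  [/\ match eshape e with
      | Segment l => 0 < l
      | Loop l => 0 < l /\ forall s, epath e (s + l) = epath e s
      | Ray => True
      | Line => True
      end,
      forall s, edom e s -> smooth_curve_near (epath e) s,
      forall s, edom e s -> enorm (derive1 (epath e) s) = 1 &
      {in edom_interior e &, injective (epath e)}].

(* The edges are those with index in [gedges]. *)
Record graph (R : realType) : Type := Graph {
  gverts : set (plane R);
  gedges : set nat;
  gedge : nat -> edge R
}.

Definition gpoints (R : realType) (G : graph R) : set (plane R) :=
  gverts G `|` \bigcup_(k in gedges G) epoints (gedge G k).

(* The last clause (finite arc length in every compact set) is what makes the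
   arc length integral of a test function finite, so that it defines a
   distribution. It excludes an edge of infinite length that stays in a bounded
   region, such as a spiral winding infinitely often around a vertex. *)
Definition smooth_graph (R : realType) (G : graph R) : Prop :=
  [/\ closed (gpoints G), countable (gverts G) &
      forall k, gedges G k -> smooth_edge (gedge G k)] /\
  [/\ forall k, gedges G k -> eendpoints (gedge G k) `<=` gverts G,
      forall k l, gedges G k -> gedges G l -> k <> l ->
        einterior (gedge G k) `&` einterior (gedge G l) = set0 &
      forall k, gedges G k -> einterior (gedge G k) `&` gverts G = set0] /\
  [/\ forall v w, gverts G v -> gverts G w ->
        finite_set [set k | gedges G k /\ joins (gedge G k) v w],
      forall K : set (plane R), compact K ->
        finite_set (K `&` gverts G) /\
        finite_set [set k | gedges G k /\ K `&` epoints (gedge G k) !=set0] &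
      forall (K : set (plane R)) k, compact K -> gedges G k ->
        (lebesgue_measure (edom (gedge G k) `&` epath (gedge G k) @^-1` K)
           < +oo)%E].

Definition singular_points (R : realType) (S : set (plane R)) :
    set (plane R) :=
  [set p | S p /\ ~ embedded_curve_near S p].

(* The sum has only finitely many nonzero terms when [f] has compact support. *)
Definition arc_length_integral (R : realType) (G : graph R)
    (f : plane R -> R) : R :=
  \sum_(k \in gedges G)
    \int[@lebesgue_measure R]_(s in edom (gedge G k)) f (epath (gedge G k) s).

Definition level_set_function (R : realType) (S : set (plane R))
    (phi : plane R -> R) : Prop :=
  S = [set p | phi p = 0] /\
  forall p, (S `\` singular_points S) p ->
    smooth_near phi p /\ enorm (grad phi p) != 0.

Definition signed_distance (R : realType) (S : set (plane R))
    (phi : plane R -> R) (p : plane R) : R :=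
  Num.sg (phi p) * inf [set enorm (p - q) | q in S].

(* The coordinates (rho, s) |-> x(s) + rho n(s), with |rho| < [t_width], along
   the arc x(s), s in [t_start, t_end], with unit normal n. *)
Record tube (R : realType) : Type := Tube {
  t_start : R;
  t_end : R;
  t_path : R -> plane R;
  t_normal : R -> plane R;
  t_width : R
}.

Definition tube_map (R : realType) (T : tube R) (r s : R) : plane R :=
  t_path T s + r *: t_normal T s.

Definition tube_jacobian (R : realType) (T : tube R) (r s : R) : R :=
  let Xr := derive1 (fun r' => tube_map T r' s) r in
  let Xs := derive1 (tube_map T r) s in
  `| Xr.1 * Xs.2 - Xr.2 * Xs.1 |.

Definition dphi_drho (R : realType) (phi : plane R -> R) (T : tube R)
    (r s : R) : R :=
  derive1 (fun r' => phi (tube_map T r' s)) r.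

(* The first tube coordinate as a function of the coordinates (phi, s). *)
Definition rho_of_phi (R : realType) (phi : plane R -> R) (T : tube R)
    (t s : R) : R :=
  xget 0 [set r | `|r| < t_width T /\ phi (tube_map T r s) = t].

Definition tube_arc (R : realType) (T : tube R) : set (plane R) :=
  t_path T @` `[t_start T, t_end T].

Definition admissible_arc (R : realType) (S : set (plane R)) (T : tube R) :
    Prop :=
  [/\ t_start T < t_end T,
      tube_arc T `<=` S `\` singular_points S,
      {in `[t_start T, t_end T] &, injective (t_path T)} &
      forall s, s \in `[t_start T, t_end T] ->
        smooth_curve_near (t_path T) s /\ enorm (derive1 (t_path T) s) = 1].

Definition unit_normal_to_positive_side (R : realType) (phi : plane R -> R)
    (T : tube R) : Prop :=
  forall s, s \in `[t_start T, t_end T] ->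
    [/\ smooth_curve_near (t_normal T) s,
        enorm (t_normal T s) = 1,
        dotp (t_normal T s) (derive1 (t_path T) s) = 0 &
        \forall r \near 0^'+, 0 < phi (tube_map T r s)].

(* [t_width] is small enough: (rho, s) and (phi, s) are coordinates on the tube
   and rho is the signed distance. *)
Definition tube_coordinates (R : realType) (S : set (plane R))
    (phi : plane R -> R) (T : tube R) : Prop :=
  [/\ 0 < t_width T,
      forall r s r' s', `|r| < t_width T -> `|r'| < t_width T ->
        s \in `[t_start T, t_end T] -> s' \in `[t_start T, t_end T] ->
        tube_map T r s = tube_map T r' s' -> r = r' /\ s = s' &
      forall r s, `|r| < t_width T -> s \in `[t_start T, t_end T] ->
        [/\ tube_jacobian T r s != 0,
            signed_distance S phi (tube_map T r s) = r,
            smooth_near phi (tube_map T r s) &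
            0 < dphi_drho phi T r s]].

(* The data chosen for a given epsilon: a neighbourhood of each singular point,
   finitely many arcs with their tubes, and the cut-off functions. *)
Record localization (R : realType) : Type := Localization {
  l_nbhd : plane R -> set (plane R);
  l_size : nat;
  l_tube : 'I_l_size -> tube R;
  l_cutoff : 'I_l_size -> plane R -> R
}.

Definition l_excised (R : realType) (S : set (plane R)) (c : localization R) :
    set (plane R) :=
  \bigcup_(p in singular_points S) l_nbhd c p.

Definition boundary (R : realType) (U : set (plane R)) : set (plane R) :=
  closure U `\` interior U.

Definition admissible_excision (R : realType) (S : set (plane R)) (eps : R)
    (c : localization R) : Prop :=
  let P := singular_points S in
  let U := l_excised S c in
  [/\ forall p, P p ->
        [/\ open (l_nbhd c p), l_nbhd c p p & bounded_set (l_nbhd c p)],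
      trivIset P (l_nbhd c),
      U `<=` [set q | exists2 p, P p & enorm (q - p) < eps] &
      forall q, S q -> boundary U q ->
        embedded_curve_near (boundary U) q /\
        forall v w, tangent_vector (boundary U) q v -> tangent_vector S q w ->
          dotp v w = 0].

Definition admissible (R : realType) (S : set (plane R)) (phi f : plane R -> R)
    (eps : R) (c : localization R) : Prop :=
  [/\ admissible_excision S eps c,
      forall i : 'I_(l_size c),
        [/\ admissible_arc S (l_tube i),
            unit_normal_to_positive_side phi (l_tube i) &
            tube_coordinates S phi (l_tube i)],
      forall i : 'I_(l_size c),
        test_function (l_cutoff i) /\
        tsupp (l_cutoff i) `&` S `<=` tube_arc (l_tube i) &
      forall p, ((S `\` l_excised S c) `&` tsupp f) p ->
        \forall q \near p, \sum_(i < l_size c) l_cutoff i q = 1].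

(* The integral of [delta(t) g(t)] over the line. *)
Definition delta_integral (R : realType) (g : R -> R) : R := g 0.

(* In both sums the integrand in [s] is a total function; its value at the
   finitely many s with x(s) on the boundary of the excised set is irrelevant. *)
Definition delta_rho_sum (R : realType) (S : set (plane R)) (f : plane R -> R)
    (c : localization R) : R :=
  \sum_(i < l_size c)
    \int[@lebesgue_measure R]_(s in `[t_start (l_tube i), t_end (l_tube i)])
      delta_integral (fun rho =>
        let p := tube_map (l_tube i) rho s in
        \1_(~` l_excised S c) p * f p * l_cutoff i p
        * tube_jacobian (l_tube i) rho s).

Definition delta_phi_sum (R : realType) (S : set (plane R))
    (phi f : plane R -> R) (c : localization R) : R :=
  \sum_(i < l_size c)
    \int[@lebesgue_measure R]_(s in `[t_start (l_tube i), t_end (l_tube i)])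
      delta_integral (fun t =>
        let rho := rho_of_phi phi (l_tube i) t s in
        let p := tube_map (l_tube i) rho s in
        \1_(~` l_excised S c) p * f p * l_cutoff i p * enorm (grad phi p)
        * tube_jacobian (l_tube i) rho s * (dphi_drho phi (l_tube i) rho s)^-1).

(* Main.v *)
(** On the curve both integrands reduce to [chi_eps f h_i]: the tube Jacobian is
    1 at [rho = 0], and since [phi] vanishes along the arc its gradient is
    normal to it, so that [|grad phi| = d phi / d rho].

    It remains to compare the arcs with the edges, that is, two unrelated arc
    length parametrizations of the same points. If [c2] is injective with unit
    speed on a compact interval, then points [c2 s] and [c2 s'] that are close
    satisfy [k |s - s'| <= |c2 s - c2 s'|] for any given [k < 1], whereas
    [|c1 t - c1 t'| <= |t - t'|]. So [c2^-1 \o c1] increases outer Lebesgue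
    measure at most by the factor [1/k]; letting [k] tend to 1 and exchanging
    the roles of the curves, it preserves measure. Hence a function on the plane
    has the same distribution along both curves, and the same integral.

    The singular points have disjoint open neighbourhoods, so they are countable
    and carry no length; as they form a closed set, the excised parts shrink to
    a null set, and dominated convergence gives the limit. *)

Require Import Defs.
From HB Require Import structures.
From mathcomp Require Import all_boot all_order all_algebra.
From mathcomp Require Import all_classical all_reals all_analysis.
From mathcomp Require Import measurable_realfun.
From mathcomp Require Import ring lra.
Set Implicit Arguments.
Unset Strict Implicit.
Unset Printing Implicit Defensive.
Import Order.TTheory GRing.Theory Num.Theory.
Import numFieldNormedType.Exports.
Local Open Scope classical_set_scope.
Local Open Scope ring_scope.

(** * Euclidean norm and differentiation along plane curves *)

Lemma dotpBl (R : realType) (v w z : plane R) :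
  dotp (v - w) z = dotp v z - dotp w z.
Proof. by case: v w z => [a b] [c d] [e f]; rewrite /dotp /=; ring. Qed.

Lemma dotp_ge0 (R : realType) (v : plane R) : 0 <= dotp v v.
Proof. by rewrite /dotp; nra. Qed.

Lemma enorm_ge0 (R : realType) (v : plane R) : 0 <= enorm v.
Proof. exact: sqrtr_ge0. Qed.

Lemma sqr_enorm (R : realType) (v : plane R) : enorm v ^+ 2 = dotp v v.
Proof. by rewrite /enorm sqr_sqrtr// dotp_ge0. Qed.

(** Cauchy-Schwarz by Lagrange's identity: the defect of the squares is [(a * d - b * c) ^+ 2]. *)
Lemma dotp_le_enorm (R : realType) (v w : plane R) :
  dotp v w <= enorm v * enorm w.
Proof.
rewrite (le_trans (ler_norm _))// -ler_sqr ?nnegrE// ?mulr_ge0 ?enorm_ge0//.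
rewrite real_normK ?num_real// exprMn !sqr_enorm.
case: v w => [a b] [c d]; rewrite /dotp /= -subr_ge0.
have -> : (a * a + b * b) * (c * c + d * d) - (a * c + b * d) ^+ 2 =
  (a * d - b * c) ^+ 2 by ring.
exact: sqr_ge0.
Qed.

Lemma enorm0_eq0 (R : realType) (v : plane R) : enorm v = 0 -> v = 0.
Proof.
move=> v0; have := sqr_enorm v; rewrite v0 expr0n /=.
case: v {v0} => [a b]; rewrite /dotp /= => /esym/eqP.
rewrite -!expr2 paddr_eq0 ?sqr_ge0// !sqrf_eq0.
by move=> /andP[/eqP -> /eqP ->].
Qed.

Lemma abs_fst_le_enorm (R : realType) (v : plane R) : `|v.1| <= enorm v.
Proof.
rewrite -ler_sqr ?nnegrE ?enorm_ge0// real_normK ?num_real// sqr_enorm /dotp.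
by nra.
Qed.

Lemma abs_snd_le_enorm (R : realType) (v : plane R) : `|v.2| <= enorm v.
Proof.
rewrite -ler_sqr ?nnegrE ?enorm_ge0// real_normK ?num_real// sqr_enorm /dotp.
by nra.
Qed.

(** Links Euclidean estimates with the library balls, which are those of the sup norm. *)
Lemma norm_le_enorm (R : realType) (v : plane R) : `|v| <= enorm v.
Proof. by rewrite prod_normE ge_max abs_fst_le_enorm abs_snd_le_enorm. Qed.

Lemma continuous_dotpl (R : realType) (v : plane R) :
  continuous (fun w : plane R => dotp w v).
Proof.
move=> w; apply: cvgD; apply: cvgM; try exact: cvg_cst.
  exact: cvg_fst.
exact: cvg_snd.
Qed.

Lemma continuous_enorm (R : realType) : continuous (@enorm R).
Proof.
move=> w; apply: (@continuous_comp _ _ _ (fun v : plane R => dotp v v) Num.sqrt).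
  by apply: cvgD; apply: cvgM; try exact: cvg_fst; exact: cvg_snd.
exact: sqrt_continuous.
Qed.

Lemma dotpl_is_linear (R : realType) (v : plane R) :
  linear (fun w : plane R => dotp w v).
Proof.
move=> a [x y] [z t]; case: v => [b c].
by rewrite /dotp /= -![a *: _]/(a * _); ring.
Qed.

Lemma is_diff_dotpl (R : realType) (v p : plane R) :
  is_diff p (fun w : plane R => dotp w v) (fun w : plane R => dotp w v).
Proof.
pose L := GRing.isLinear.Build _ _ _ _ _ (dotpl_is_linear v).
pose f : {linear plane R -> R} := HB.pack (fun w : plane R => dotp w v) L.
have cf : continuous f by exact: continuous_dotpl.
by apply: DiffDef; [exact: (linear_differentiable _ cf)|exact: (diff_lin _ cf)].
Qed.

Lemma is_derive_comp_curve (R : realType) (g : plane R -> R)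
    (c : R -> plane R) (s : R) :
  derivable c s 1 -> differentiable g (c s) ->
  is_derive s 1 (g \o c) ('d g (c s) (derive1 c s)).
Proof.
move=> /derivable1_diffP dc dg; apply: DeriveDef.
  by apply/derivable1_diffP/differentiable_comp.
rewrite deriveE; last exact: differentiable_comp.
by rewrite diff_comp//= derive1E'.
Qed.

Lemma is_derive_dotp_curve (R : realType) (v : plane R) (c : R -> plane R)
    (s : R) : derivable c s 1 ->
  is_derive s 1 (fun t => dotp (c t) v) (dotp (derive1 c s) v).
Proof.
move=> dc; have [dv dvE] := is_diff_dotpl v (c s).
by have := is_derive_comp_curve dc dv; rewrite dvE.
Qed.

Lemma diff_planeE (R : realType) (g : plane R -> R) (p v : plane R) :
  differentiable g p -> 'd g p v = dotp (grad g p) v.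
Proof.
move=> dg; rewrite /grad /partial /dotp /= !deriveE//.
rewrite mulrC [X in _ + X]mulrC.
rewrite -[v.1 * _]/(v.1 *: ('d g p (1, 0) : R)) -[v.2 * _]/(v.2 *: ('d g p (0, 1) : R)).
rewrite -!linearZ -linearD; congr ('d g p _).
by case: v => a b; congr pair;
  rewrite /= -![_ *: _]/(_ * _) ?mulr0 ?mulr1 ?addr0 ?add0r.
Qed.

Lemma smooth_near_differentiable (R : realType) (g : plane R -> R)
    (p : plane R) : smooth_near g p -> differentiable g p.
Proof. by move=> /nbhs_singleton /(_ [::]). Qed.

Lemma smooth_curve_derivable (R : realType) (c : R -> plane R) (s : R) :
  smooth_curve_near c s -> derivable c s 1.
Proof. by move=> /nbhs_singleton /(_ 0%N). Qed.

Lemma smooth_curve_continuous (R : realType) (c : R -> plane R) (s : R) :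
  smooth_curve_near c s -> {for s, continuous c}.
Proof.
by move=> /smooth_curve_derivable/derivable1_diffP/differentiable_continuous.
Qed.

Lemma smooth_curve_derive_continuous (R : realType) (c : R -> plane R) (s : R) :
  smooth_curve_near c s -> {for s, continuous (derive1 c)}.
Proof.
move=> /nbhs_singleton /(_ 1%N).
by move=> /derivable1_diffP/differentiable_continuous.
Qed.

(** * Distances between points of a unit speed curve *)

Definition unit_speed_on (R : realType) (c : R -> plane R) (D : set R) : Prop :=
  forall s, D s -> smooth_curve_near c s /\ enorm (derive1 c s) = 1.

(** The mean value theorem fails for plane-valued functions, so it is applied to the component along
    a fixed vector [v], chosen at each use. *)
Lemma curve_mean_value (R : realType) (c : R -> plane R) (v : plane R)
    (s t : R) : s <= t ->
  (forall u, u \in `[s, t] -> smooth_curve_near c u) ->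
  exists2 u, u \in `[s, t] &
    dotp (c t - c s) v = dotp (derive1 c u) v * (t - s).
Proof.
move=> st cs; have cd u : u \in `[s, t] ->
    is_derive u 1 (fun t => dotp (c t) v) (dotp (derive1 c u) v).
  by move=> /cs/smooth_curve_derivable; exact: is_derive_dotp_curve.
have [u ust uE] := @MVT_segment R (fun t => dotp (c t) v)
  (fun u => dotp (derive1 c u) v) s t st (fun u ust => cd u (subset_itv_oo_cc ust))
  (@derivable_within_continuous _ _ _ `[s, t] (fun u ust => @ex_derive _ _ _ _ _ _ _ (cd u ust))).
by exists u => //; rewrite dotpBl.
Qed.

(** With [v] the chord itself, the mean value theorem and Cauchy-Schwarz give
    [|v|^2 <= |v| |t - t'|]. *)
Lemma unit_speed_lipschitz (R : realType) (c : R -> plane R) (a b t t' : R) :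
  unit_speed_on c `[a, b] -> t \in `[a, b] -> t' \in `[a, b] ->
  enorm (c t - c t') <= `|t - t'|.
Proof.
move=> cab; wlog tt' : t t' / t' <= t.
  move=> H; have [/H//|/ltW /H tt' tab tab'] := leP t' t.
  rewrite distrC; apply: le_trans (tt' tab' tab).
  rewrite /enorm /dotp; case: (c t) (c t') => [x y] [z w] /=.
  by rewrite -[x - z]opprB -[y - w]opprB !mulrNN.
move=> tab tab'; set v := c t - c t'.
have [|u ut vE] := @curve_mean_value R c v t' t tt'.
  move=> u ut; apply: (proj1 (cab u _)).
  by move: ut tab tab'; rewrite /= !in_itv /=; lra.
have [_ cu] : smooth_curve_near c u /\ enorm (derive1 c u) = 1.
  by apply: cab; move: ut tab tab'; rewrite /= !in_itv /=; lra.
have := dotp_le_enorm (derive1 c u) v; rewrite cu mul1r => cuv.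
rewrite ger0_norm ?subr_ge0//.
(* A zero chord is treated apart because [enorm v] is cancelled below. *)
have := enorm_ge0 v; rewrite le_eqVlt => /predU1P[<-|v0]; first by rewrite subr_ge0.
rewrite -(ler_pM2l v0) -expr2 sqr_enorm vE.
by rewrite ler_wpM2r// subr_ge0.
Qed.

(** The component of the velocity along the tangent at [s0] is 1 at [s0], hence stays above [k]
    nearby; the chord then advances in that direction at rate at least [k]. *)
Lemma unit_speed_local_expansion (R : realType) (c : R -> plane R) (s0 k : R) :
  smooth_curve_near c s0 -> enorm (derive1 c s0) = 1 -> k < 1 ->
  \forall z \near (s0, s0), k * `|z.1 - z.2| <= enorm (c z.1 - c z.2).
Proof.
move=> cs0 c1 k1; set v := derive1 c s0.
have ck : \forall s \near s0, k < dotp (derive1 c s) v.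
  have : (fun s => dotp (derive1 c s) v) @ s0 --> dotp v v.
    apply: (@continuous_comp _ _ _ (derive1 c) (fun w => dotp w v)).
      exact: smooth_curve_derive_continuous.
    exact: continuous_dotpl.
  move=> /cvgr_gt; apply.
  by rewrite -sqr_enorm c1 expr1n.
have cd : \forall s \near s0, smooth_curve_near c s.
  exact: (nbhs_interior cs0).
have [e /= e0 He] : exists2 e : R, 0 < e & forall s, ball s0 e s ->
    k < dotp (derive1 c s) v /\ smooth_curve_near c s.
  by have [e /= e0 He] := filterI ck cd; exists e.
have main s t : ball s0 e s -> ball s0 e t -> s <= t ->
    k * (t - s) <= enorm (c t - c s).
  move=> bs bt st.
  have but u : u \in `[s, t] -> ball s0 e u.
    move: bs bt; rewrite /ball /= !ltr_norml in_itv /=; lra.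
  have [u /but/He[ku _] uE] := @curve_mean_value R c v s t st (fun u ut => (He u (but u ut)).2).
  (* Since [enorm v = 1], the length of the chord bounds its component along [v]. *)
  rewrite -[leRHS]mulr1 -c1; apply: le_trans (dotp_le_enorm _ _).
  by rewrite uE ler_wpM2r ?subr_ge0// ltW.
exists (ball s0 e, ball s0 e) => /=.
  by split; exact: nbhsx_ballx.
move=> [s t] [/= bs bt]; have [st|/ltW st] := leP s t.
  rewrite distrC ger0_norm ?subr_ge0//; apply: le_trans (main _ _ bs bt st) _.
  rewrite /enorm /dotp; case: (c t) (c s) => [x y] [z w] /=.
  by rewrite -[x - z]opprB -[y - w]opprB !mulrNN.
by rewrite ger0_norm ?subr_ge0//; exact: main.
Qed.

(** Compactness of the square of parameters: near a diagonal point the local expansion applies, and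
    near any other point injectivity keeps the two images apart, so that the premise fails for small
    [e]. *)
Lemma unit_speed_inverse_lipschitz (R : realType) (c : R -> plane R)
    (p q k : R) : unit_speed_on c `[p, q] -> {in `[p, q] &, injective c} ->
  k < 1 ->
  \forall e \near 0^'+, forall s s', s \in `[p, q] -> s' \in `[p, q] ->
    enorm (c s - c s') <= e -> k * `|s - s'| <= enorm (c s - c s').
Proof.
move=> cpq ci k1.
(* In its covering form, compactness makes one range of [e] serve all pairs of parameters. *)
have /compact_near_coveringP cK : compact (`[p, q] `*` `[p, q] : set (R * R)).
  by apply: compact_setX; exact: segment_compact.
have := cK R (0^'+) (fun e z => enorm (c z.1 - c z.2) <= e ->
  k * `|z.1 - z.2| <= enorm (c z.1 - c z.2)) _ _.
move=> /(_ _ _)/=; case.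
  move=> [s s'] [/= sp sp'].
  have [ss'|ss'] := eqVneq s s'.
    subst s'; have [cs c1] := cpq _ sp.
    have := unit_speed_local_expansion cs c1 k1 => H.
    near=> z e => /= _; near: z; exact: H.
  have d0 : 0 < enorm (c s - c s').
    rewrite lt_neqAle enorm_ge0 andbT eq_sym; apply/eqP => /enorm0_eq0/subr0_eq.
    by move=> /(ci _ _ sp sp') /eqP; rewrite (negbTE ss').
  have cd : (fun z : R * R => enorm (c z.1 - c z.2)) @ (s, s') --> enorm (c s - c s').
    apply: (@cvg_comp _ _ _ (fun z : R * R => c z.1 - c z.2) (@enorm R) _
      (nbhs (c s - c s'))); last exact: continuous_enorm.
    apply: cvgB.
      apply: (@cvg_comp _ _ _ fst c _ (nbhs s)); first exact: cvg_fst.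
      exact: smooth_curve_continuous (cpq _ sp).1.
    apply: (@cvg_comp _ _ _ snd c _ (nbhs s')); first exact: cvg_snd.
    exact: smooth_curve_continuous (cpq _ sp').1.
  (* Near [(s, s')] the distance stays above half its value there, and [e] is taken below that
     half. *)
  have cd2 : \forall z \near (s, s'), enorm (c s - c s') / 2 < enorm (c z.1 - c z.2).
    by apply: (cvgr_gt _ cd); lra.
  near=> z e => /=.
  have : enorm (c s - c s') / 2 < enorm (c z.1 - c z.2) by near: z; exact: cd2.
  have : e < enorm (c s - c s') / 2.
    by near: e; apply: nbhs_right_lt; lra.
  by move=> + + /=; lra.
move=> e e0 He /=.
exists e => // x /He{}He x0 s s' sp sp'.
by apply: (He x0 (s, s')).
Unshelve. all: by end_near. Qed.

(** * Outer Lebesgue measure and relations with controlled expansion *)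

(* [lebesgue_measure] is by definition an outer measure defined on all sets,
   so no measurability is needed here. *)
Lemma lebesgue_outer_le (R : realType) (A B : set R) :
  A `<=` B -> (lebesgue_measure A <= lebesgue_measure B)%E.
Proof. exact: (@le_outer_measure _ _ ((@wlength R idfun)^*)%mu). Qed.

Lemma lebesgue_outerU2 (R : realType) (A B : set R) :
  (lebesgue_measure (A `|` B) <= lebesgue_measure A + lebesgue_measure B)%E.
Proof. exact: (@outer_measureU2 _ _ ((@wlength R idfun)^*)%mu). Qed.

Lemma lebesgue_outer_bigcup (R : realType) (A : (set R)^nat) :
  (lebesgue_measure (\bigcup_n A n) <= \sum_(n <oo) lebesgue_measure (A n))%E.
Proof.
exact: (@outer_measure_sigma_subadditive _ _ ((@wlength R idfun)^*)%mu).
Qed.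

(** When nonempty, the set lies in the interval from its infimum to its supremum, whose length is at
    most [K]. *)
Lemma lebesgue_outer_diameter (R : realType) (S : set R) (K : R) :
  0 <= K -> (forall s t, S s -> S t -> `|s - t| <= K) ->
  (lebesgue_measure S <= K%:E)%E.
Proof.
move=> K0 SK; have [->|/set0P[s0 Ss0]] := eqVneq S set0; first by rewrite measure0 lee_fin.
have ub s : S s -> ubound S (s + K).
  by move=> Ss t St; have := SK _ _ Ss St; rewrite ler_norml; lra.
have lb s : S s -> lbound S (s - K).
  by move=> Ss t St; have := SK _ _ Ss St; rewrite ler_norml; lra.
have hs : has_sup S by split; [exists s0|exists (s0 + K); exact: ub].
have hi : has_inf S by split; [exists s0|exists (s0 - K); exact: lb].
have sS : S `<=` `[inf S, sup S].
  move=> s Ss /=; rewrite in_itv /=; apply/andP; split.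
    by apply: ge_inf => //; exact: hi.2.
  by apply: ub_le_sup => //; exact: hs.2.
apply: (le_trans (lebesgue_outer_le sS)); rewrite lebesgue_measure_itv /=.
case: ifPn => _; last by rewrite lee_fin.
rewrite -EFinB lee_fin lerBlDr -lerBlDl.
apply: lb_le_inf; first by exists s0.
by move=> s Ss; rewrite lerBlDl addrC ge_sup//; [exists s0|exact: ub].
Qed.

(* [Q] is the graph of a possibly multivalued and discontinuous map [t |-> s];
   its expansion is controlled only at scale [e], so covering intervals are cut
   into pieces of length at most [e]. *)
Lemma lebesgue_outer_contraction (R : realType) (Q : R -> R -> Prop)
    (e k : R) (A : set R) : 0 < e -> 0 < k ->
  (forall t s t' s', Q t s -> Q t' s' -> `|t - t'| <= e ->
    k * `|s - s'| <= `|t - t'|) ->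
  (k%:E * lebesgue_measure [set s | exists2 t, A t & Q t s]
    <= lebesgue_measure A)%E.
Proof.
move=> e0 k0 HQ; pose S A := [set s | exists2 t, A t & Q t s].
(* Induction on the number of pieces of length at most [e] that suffice for the interval. *)
have S_itv n : forall x y, x <= y -> y - x <= n%:R * e ->
    (lebesgue_measure (S `]x, y]%classic) <= (k^-1 * (y - x))%:E)%E.
  elim: n => [|n IH] x y xy.
    (* With no piece allowed, the half-open interval is empty. *)
    rewrite mul0r => yx; have -> : y = x by lra.
    apply: lebesgue_outer_diameter => [|s t [u]]; first by rewrite subrr mulr0.
    by rewrite /= in_itv /=; lra.
  have [yxe _|yxe] := leP (y - x) e.
    apply: lebesgue_outer_diameter => [|s t [u ux Qus] [v vx Qvt]].
      by rewrite mulr_ge0 ?subr_ge0// invr_ge0 ltW.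
    rewrite ler_pdivlMl//.
    have uv : `|u - v| <= y - x.
      by move: ux vx; rewrite /= !in_itv /= ler_norml; lra.
    by apply: (le_trans _ uv); apply: (HQ _ _ _ _ Qus Qvt); exact: (le_trans uv yxe).
  rewrite -natr1 mulrDl mul1r => yxn.
  have -> : k^-1 * (y - x) = k^-1 * (x + e - x) + k^-1 * (y - (x + e)) by ring.
  have sS : S `]x, y]%classic `<=`
      S `]x, x + e]%classic `|` S `]x + e, y]%classic.
    move=> s [t + Qts]; rewrite /= in_itv /= => /andP[xt ty].
    have [te|te] := leP t (x + e); [left|right]; exists t => //=;
      by rewrite in_itv /= ?xt ?te ?ty.
  apply: (le_trans (lebesgue_outer_le sS)).
  apply: (le_trans (lebesgue_outerU2 _ _)); rewrite EFinD; apply: leeD.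
    apply: lebesgue_outer_diameter => [|s t [u ux Qus] [v vx Qvt]].
      by rewrite mulr_ge0 ?invr_ge0 ?ltW//; lra.
    rewrite ler_pdivlMl//.
    have uv : `|u - v| <= x + e - x.
      by move: ux vx; rewrite /= !in_itv /= ler_norml; lra.
    apply: le_trans uv; apply: (HQ _ _ _ _ Qus Qvt).
    by move: ux vx; rewrite /= !in_itv /= ler_norml; lra.
  by apply: IH; lra.
have S_ocitv X : ocitv X ->
    (lebesgue_measure (S X) <= (k^-1)%:E * wlength idfun X)%E.
  move=> /ocitvP[->|[[x y] /= xy ->]].
    rewrite wlength0 mule0.
    apply: (@le_trans _ _ (lebesgue_measure (set0 : set R))); last by rewrite measure0.
    by apply: lebesgue_outer_le => s [].
  rewrite wlength_itv_bnd /=; last exact: ltW.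
  rewrite -EFinM.
  have yxe : 0 <= (y - x) / e by apply: divr_ge0; rewrite ?subr_ge0; exact: ltW.
  (* One more than the integer part of [(y - x) / e], so that the pieces reach [y]. *)
  apply: (S_itv (Num.truncn ((y - x) / e)).+1); first exact: ltW.
  by rewrite -ler_pdivrMr// ltW// truncnS_gt.
(* The outer measure of [A] is an infimum over countable covers by half-open intervals, so each
   cover is estimated separately. *)
rewrite [leRHS]/lebesgue_measure /lebesgue_stieltjes_measure /measure_extension.
apply: le_ereal_inf_tmp => _ [F [mF AF] <-].
have -> : (\sum_(n <oo) wlength idfun (F n) =
    k%:E * \sum_(n <oo) ((k^-1)%:E * wlength idfun (F n)))%E.
  rewrite -nneseriesZl; last by move=> n _; rewrite mule_ge0// lee_fin invr_ge0 ltW.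
  by apply: eq_eseriesr => n _; rewrite muleA -EFinM mulfV ?gt_eqF// mul1e.
apply: lee_wpmul2l; first by rewrite lee_fin ltW.
have sF : S A `<=` \bigcup_n S (F n).
  by move=> s [t /AF [n _ Fnt] Qts]; exists n => //; exists t.
apply: (le_trans (lebesgue_outer_le sF)).
apply: (le_trans (lebesgue_outer_bigcup _)).
by apply: lee_nneseries => // n _; exact: S_ocitv (mF n).
Qed.

(** The relation [c1 t = c2 s] satisfies the hypothesis of [lebesgue_outer_contraction] for every
    positive [k < 1]: [c1] does not increase distances, and at small scale [c2] shrinks them at most
    by the factor [k]. *)
Lemma unit_speed_outer_le (R : realType) (c1 c2 : R -> plane R)
    (a b p q : R) (X1 X2 : set R) :
  unit_speed_on c1 `[a, b] -> unit_speed_on c2 `[p, q] ->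
  {in `[p, q] &, injective c2} ->
  X1 `<=` `[a, b] -> X2 `<=` `[p, q] -> c2 @` X2 `<=` c1 @` X1 ->
  (lebesgue_measure X2 <= lebesgue_measure X1)%E.
Proof.
move=> u1 u2 i2 X1ab X2pq X21.
have kle k : 0 < k -> k < 1 ->
    (k%:E * lebesgue_measure X2 <= lebesgue_measure X1)%E.
  move=> k0 k1; have := unit_speed_inverse_lipschitz u2 i2 k1.
  move=> [e /= e0 He].
  pose Q t s := [/\ t \in `[a, b], s \in `[p, q] & c1 t = c2 s].
  (* The scales provided are those strictly between 0 and [e]; half of [e] is one of them. *)
  have e20 : 0 < e / 2 by lra.
  have := @lebesgue_outer_contraction R Q (e / 2) k X1 e20 k0.
  move=> H; apply: le_trans (H _); last first.
    move=> t s t' s' [tab spq ts] [tab' spq' ts'] tt'.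
    have l1 := unit_speed_lipschitz u1 tab tab'.
    apply: (le_trans _ l1); rewrite ts ts'; apply: (He (e / 2)) => //=.
      by rewrite sub0r normrN gtr0_norm//; lra.
    by rewrite -ts -ts'; exact: (le_trans l1 tt').
  apply: lee_wpmul2l; first by rewrite lee_fin ltW.
  apply: lebesgue_outer_le => s X2s.
  have [t X1t ts] : (c1 @` X1) (c2 s) by apply: X21; exists s.
  by exists t => //; split => //; [exact: X1ab|exact: X2pq].
(* Letting [k] tend to 1. *)
apply/lee_mul01Pr => [|k /andP[k0 k1]]; [exact: measure_ge0|exact: kle].
Qed.

(** * Measurability along curves and equality of measures on two curves *)

(** At each point of [D], [c] is continuous as a function on the line, so the points of [D] sent
    into [U] are interior to the preimage, which may be replaced by its open interior. *)
Lemma measurable_preimage_open (R : realType) (V : topologicalType) (c : R -> V)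
    (D : set R) (U : set V) : measurable D -> (forall s, D s -> {for s, continuous c}) ->
  open U -> measurable (D `&` c @^-1` U).
Proof.
move=> mD cD oU.
rewrite (_ : _ `&` _ = D `&` (c @^-1` U)^°).
  by apply: measurableI => //; apply: open_measurable; exact: open_interior.
apply/seteqP; split => s [Ds cs]; split => //; last exact: interior_subset cs.
by apply: (cD s Ds); exact: open_nbhs_nbhs.
Qed.

Lemma measurable_preimage_closed (R : realType) (V : topologicalType) (c : R -> V)
    (D : set R) (F : set V) : measurable D -> (forall s, D s -> {for s, continuous c}) ->
  closed F -> measurable (D `&` c @^-1` F).
Proof.
move=> mD cD cF.
rewrite (_ : _ `&` _ = D `\` (D `&` c @^-1` (~` F))).
  apply: measurableD => //; apply: measurable_preimage_open => //.
  exact: closed_openC.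
apply/seteqP; split => s [Ds cs]; split => //; first by move=> [].
by apply: contrapT => Fcs; apply: cs.
Qed.

Lemma measurable_fun_comp_curve (R : realType) (c : R -> plane R) (D : set R)
    (g : plane R -> R) : measurable D -> (forall s, D s -> {for s, continuous c}) ->
  continuous g -> measurable_fun D (g \o c).
Proof.
move=> mD cD cg; apply: subspace_continuous_measurable_fun => //.
apply: continuous_in_subspaceT => s /set_mem Ds.
by apply: continuous_comp; [exact: cD|exact: cg].
Qed.

Lemma unit_speed_closed_image (R : realType) (c : R -> plane R) (p q : R) :
  unit_speed_on c `[p, q] -> closed (c @` `[p, q]).
Proof.
move=> u; apply: compact_closed; first exact: norm_hausdorff.
apply: continuous_compact; last exact: segment_compact.
apply: continuous_in_subspaceT => s /set_mem /u[cs _].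
exact: smooth_curve_continuous.
Qed.

(** The two sets have the same image, [E] intersected with both arcs, so [unit_speed_outer_le]
    applies in each direction. *)
Lemma unit_speed_measure_eq (R : realType) (c1 c2 : R -> plane R)
    (a b p q : R) (E : set (plane R)) :
  unit_speed_on c1 `[a, b] -> {in `[a, b] &, injective c1} ->
  unit_speed_on c2 `[p, q] -> {in `[p, q] &, injective c2} ->
  lebesgue_measure (`[a, b] `&` c1 @^-1` (E `&` c2 @` `[p, q])) =
  lebesgue_measure (`[p, q] `&` c2 @^-1` (E `&` c1 @` `[a, b])).
Proof.
move=> u1 i1 u2 i2; apply/eqP; rewrite eq_le; apply/andP; split.
- apply: (unit_speed_outer_le u2 u1 i1) => [s []|s []|] //.
  move=> _ [t [tab [Et [s spq st]]] <-]; exists s => //.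
  by split => //; split; rewrite /= st //; exists t.
- apply: (unit_speed_outer_le u1 u2 i2) => [s []|s []|] //.
  move=> _ [t [tab [Et [s spq st]]] <-]; exists s => //.
  by split => //; split; rewrite /= st //; exists t.
Qed.

(* [D] is exhausted by compact intervals because the bound on [c2^-1] is uniform
   only on compact sets, while an edge may have infinite length. *)
Lemma unit_speed_measure_transfer (R : realType) (c1 c2 : R -> plane R)
    (a b : R) (p q : R^nat) (D : set R) (E : set (plane R)) :
  unit_speed_on c1 `[a, b] -> {in `[a, b] &, injective c1} ->
  unit_speed_on c2 D -> {in D &, injective c2} ->
  (forall m n, (m <= n)%N -> `[p m, q m]%classic `<=` `[p n, q n]%classic) ->
  D = \bigcup_n `[p n, q n]%classic ->
  measurable (`[a, b] `&` c1 @^-1` E) -> measurable (D `&` c2 @^-1` E) ->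
  lebesgue_measure (`[a, b] `&` c1 @^-1` (E `&` c2 @` D)) =
  lebesgue_measure (D `&` c2 @^-1` (E `&` c1 @` `[a, b])).
Proof.
move=> u1 i1 u2 i2 pq DE m1 m2.
have KD n : `[p n, q n]%classic `<=` D by rewrite DE => s sn; exists n.
have u2n n : unit_speed_on c2 `[p n, q n] by move=> s /KD/u2.
have i2n n : {in `[p n, q n] &, injective c2}.
  by move=> s t sn tn; apply: i2; apply/mem_set; exact: (KD n).
have mD : measurable D by rewrite DE; exact: bigcupT_measurable.
pose F n := `[a, b] `&` c1 @^-1` (E `&` c2 @` `[p n, q n]%classic).
pose G n := `[p n, q n]%classic `&` c2 @^-1` (E `&` c1 @` `[a, b]).
have FE : `[a, b] `&` c1 @^-1` (E `&` c2 @` D) = \bigcup_n F n.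
  apply/seteqP; split=> [t [tab [Et [s]]]|t [n _ [tab [Et [s sn st]]]]].
    by rewrite {1}DE => -[n _ sn] st; exists n => //; split => //; split => //; exists s.
  by split => //; split => //; exists s => //; exact: (KD _ _ sn).
have GE : D `&` c2 @^-1` (E `&` c1 @` `[a, b]) = \bigcup_n G n.
  apply/seteqP; split=> [s [+ Es]|s [n _ [sn Es]]].
    by rewrite {1}DE => -[n _ sn]; exists n.
  by split => //; exact: (KD _ _ sn).
have mF n : measurable (F n).
  rewrite (_ : F n = (`[a, b] `&` c1 @^-1` E) `&`
    (`[a, b] `&` c1 @^-1` (c2 @` `[p n, q n]%classic))).
    apply: measurableI => //; apply: measurable_preimage_closed => //.
      by move=> s /u1[cs _]; exact: smooth_curve_continuous.
    exact: unit_speed_closed_image.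
  by rewrite /F; apply/seteqP; split => t /=; tauto.
have mG n : measurable (G n).
  rewrite (_ : G n = (`[p n, q n]%classic `&` (D `&` c2 @^-1` E)) `&`
    (D `&` c2 @^-1` (c1 @` `[a, b]))).
    apply: measurableI; first exact: measurableI.
    apply: measurable_preimage_closed => //.
      by move=> s /u2[cs _]; exact: smooth_curve_continuous.
    exact: unit_speed_closed_image.
  rewrite /G; apply/seteqP; split => t /=; last by tauto.
  by move=> [tn [Et ct]]; have := KD _ _ tn; tauto.
have ndF : nondecreasing_seq F.
  move=> m n /pq mn; apply/subsetPset => t [tab [Et [s sm st]]].
  by split => //; split => //; exists s => //; exact: mn.
have ndG : nondecreasing_seq G.
  by move=> m n /pq mn; apply/subsetPset => s [sm Es]; split => //; exact: mn.
rewrite FE GE.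
(* Continuity from below for both increasing sequences, which have equal measures term by term. *)
have cF : lebesgue_measure \o F @ \oo --> lebesgue_measure (\bigcup_n F n).
  exact: (@nondecreasing_cvg_mu _ _ _ lebesgue_measure F mF (bigcupT_measurable _ mF) ndF).
have cG : lebesgue_measure \o G @ \oo --> lebesgue_measure (\bigcup_n G n).
  exact: (@nondecreasing_cvg_mu _ _ _ lebesgue_measure G mG (bigcupT_measurable _ mG) ndG).
have FG : lebesgue_measure \o F = lebesgue_measure \o G.
  by apply/funext => n /=; exact: unit_speed_measure_eq.
by move: cF; rewrite FG => cF; exact: (cvg_unique _ cF cG).
Qed.

(** Open ends are approached with margin [d n] and infinite ends through [n], while the closed end
    of a loop is kept; the first intervals may be empty. *)
Lemma edom_interior_exhaustion (R : realType) (e : edge R) :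
  exists p q : R^nat,
    (forall m n, (m <= n)%N -> `[p m, q m]%classic `<=` `[p n, q n]%classic) /\
    edom_interior e = \bigcup_n `[p n, q n]%classic.
Proof.
have [d [dmon dpos dsmall]] : exists d : R^nat,
    [/\ forall m n, (m <= n)%N -> d n <= d m, forall n, 0 < d n &
        forall s, 0 < s -> \forall n \near \oo, d n < s].
  exists (fun n => n.+1%:R^-1); split => [m n mn|n|s s0].
  - by rewrite lef_pV2 ?posrE// ler_nat.
  - by rewrite invr_gt0.
  - exact: (near_infty_natSinv_lt (PosNum s0)).
have nmon m n : (m <= n)%N -> (m%:R : R) <= n%:R by rewrite ler_nat.
have nbig (s : R) : \forall n \near \oo, s <= n%:R.
  exact: nbhs_infty_ger.
rewrite /edom_interior; case: (eshape e) => [l|||l].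
- exists d, (fun n => l - d n); split.
    by move=> m n /dmon mn s; rewrite /= !in_itv /=; lra.
  apply/seteqP; split => s /=; rewrite in_itv /=.
    move=> /andP[s0 sl]; near \oo => n; exists n => //=; rewrite in_itv /=.
    have : d n < s by near: n; exact: dsmall.
    have : d n < l - s by near: n; apply: dsmall; rewrite subr_gt0.
    lra.
  by move=> [n _]; have := dpos n; rewrite /= in_itv /=; lra.
- exists d, (fun n => n%:R); split.
    by move=> m n mn s; have := dmon _ _ mn; have := nmon _ _ mn; rewrite /= !in_itv /=; lra.
  apply/seteqP; split => s /=; rewrite in_itv /=.
    rewrite andbT => s0; near \oo => n; exists n => //=; rewrite in_itv /=.
    have : d n < s by near: n; exact: dsmall.
    have : s <= n%:R by near: n; exact: nbig.
    lra.
  by move=> [n _]; have := dpos n; rewrite /= in_itv /= andbT; lra.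
- exists (fun n => - n%:R), (fun n => n%:R); split.
    by move=> m n /nmon mn s; rewrite /= !in_itv /=; lra.
  apply/seteqP; split => s //= _.
  near \oo => n; exists n => //=; rewrite in_itv /=.
  have : s <= n%:R by near: n; exact: nbig.
  have : - s <= n%:R by near: n; exact: nbig.
  lra.
- exists (fun n => 0), (fun n => l - d n); split.
    by move=> m n /dmon mn s; rewrite /= !in_itv /=; lra.
  apply/seteqP; split => s /=; rewrite in_itv /=.
    move=> /andP[s0 sl]; near \oo => n; exists n => //=; rewrite in_itv /=.
    have : d n < l - s by near: n; apply: dsmall; rewrite subr_gt0.
    lra.
  by move=> [n _]; have := dpos n; rewrite /= in_itv /=; lra.
Unshelve. all: by end_near. Qed.

(** * Integration lemmas and functions of equal distribution *)

Lemma bounded_integrable (d : measure_display) (T : measurableType d)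
    (R : realType) (mu : {measure set T -> \bar R}) (A : set T) (f : T -> R)
    (M : R) : measurable A -> (mu A < +oo)%E -> measurable_fun A f ->
  (forall x, A x -> `|f x| <= M) -> mu.-integrable A (EFin \o f).
Proof.
move=> mA muA mf fM; apply: measurable_bounded_integrable => //.
exists M; split; first exact: num_real.
by move=> x Mx y Ay; exact: le_trans (fM _ Ay) (ltW Mx).
Qed.

Lemma integrable_Rsum (d : measure_display) (T : measurableType d)
    (R : realType) (mu : {measure set T -> \bar R}) (D : set T) (I : eqType)
    (s : seq I) (h : I -> T -> R) : measurable D ->
  (forall i, i \in s -> mu.-integrable D (EFin \o h i)) ->
  mu.-integrable D (EFin \o (fun x => \sum_(i <- s) h i x)).
Proof.
move=> mD ih; rewrite (_ : _ \o _ = fun x => (\sum_(i <- s | i \in s) (h i x)%:E)%E).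
  exact: (@integrable_sum _ _ _ mu D mD I s [in s] (fun i => EFin \o h i) ih).
by apply/funext => x /=; rewrite big_seq sumEFin.
Qed.

Lemma Rintegral_sum (d : measure_display) (T : measurableType d)
    (R : realType) (mu : {measure set T -> \bar R}) (D : set T) (I : eqType)
    (s : seq I) (h : I -> T -> R) : measurable D ->
  (forall i, i \in s -> mu.-integrable D (EFin \o h i)) ->
  \int[mu]_(x in D) (\sum_(i <- s) h i x) =
  \sum_(i <- s) \int[mu]_(x in D) h i x.
Proof.
move=> mD; elim: s => [_|i s IH ih].
  by rewrite big_nil; under eq_Rintegral do rewrite big_nil; rewrite Rintegral_cst// mul0r.
have is' j : j \in s -> mu.-integrable D (EFin \o h j).
  by move=> js; apply: ih; rewrite in_cons js orbT.
rewrite big_cons -IH// -RintegralD//; last 2 first.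
  by apply: ih; rewrite mem_head.
  exact: integrable_Rsum.
by apply: eq_Rintegral => x _; rewrite big_cons.
Qed.

Lemma Rintegral_restrict (d : measure_display) (T : measurableType d)
    (R : realType) (mu : {measure set T -> \bar R}) (D P : set T) (f : T -> R) :
  (forall x, D x -> ~ P x -> f x = 0) ->
  \int[mu]_(x in D) f x = \int[mu]_(x in D `&` P) f x.
Proof.
move=> f0; rewrite Rintegral_mkcondr; apply: eq_Rintegral => x /set_mem Dx.
by rewrite patchE; case: ifPn => // /negP Px; apply: f0 => // /mem_set.
Qed.

Lemma Rintegral_negligible (d : measure_display) (T : measurableType d)
    (R : realType) (mu : {measure set T -> \bar R}) (D N : set T) (f : T -> R) :
  measurable N -> measurable D -> mu.-integrable D (EFin \o f) -> mu N = 0%E ->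
  \int[mu]_(x in D) f x = \int[mu]_(x in D `\` N) f x.
Proof. by move=> mN mD fi N0; rewrite /Rintegral (negligible_integral mN). Qed.

Lemma countable_measurableR (R : realType) (A : set R) :
  countable A -> measurable A.
Proof.
by apply: countable_measurable => t; exact: measurable_set1.
Qed.

(* Restriction extends [u] and [v] by 0, so the pushforwards to the line agree
   only away from 0, which is enough since [y] vanishes there. *)
Lemma eq_distribution_Rintegral (d : measure_display) (T : measurableType d)
    (R : realType) (mu : {measure set T -> \bar R}) (D1 D2 : set T)
    (u v : T -> R) : measurable D1 -> measurable D2 ->
  mu.-integrable D1 (EFin \o u) -> mu.-integrable D2 (EFin \o v) ->
  (forall C, measurable C -> mu (D1 `&` u @^-1` C) = mu (D2 `&` v @^-1` C)) ->
  \int[mu]_(x in D1) u x = \int[mu]_(x in D2) v x.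
Proof.
move=> mD1 mD2 iu iv uv.
have mw0 D (w : T -> R) : measurable D -> mu.-integrable D (EFin \o w) ->
    measurable_fun setT (w \_ D).
  move=> mD iw; apply: (measurable_restrictT w mD).1.
  by apply/measurable_EFinP; exact: (measurable_int mu iw).
(* Each integral becomes an integral of the identity against a pushforward to the line. *)
have pushE D (w : T -> R) : measurable D -> mu.-integrable D (EFin \o w) ->
    (\int[mu]_(x in D) (w x)%:E =
     \int[pushforward mu (w \_ D)]_(y in ~` [set (0%R : R)]) y%:E)%E.
  move=> mD iw.
  have mw := mw0 _ _ mD iw.
  rewrite [RHS]integral_pushforward//.
  - rewrite integral_mkcond [RHS]integral_mkcond; apply: eq_integral => x _.
    rewrite /= !patchE /= !patchE; case: ifPn => xD; case: ifPn => // /negP xw.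
      apply/eqP; rewrite eqe; apply/eqP; apply: contrapT => wx; apply: xw.
      by rewrite inE /= patchE xD.
  - apply: (@integrableS _ _ _ mu setT) => //.
      by rewrite -[X in measurable X]setTI; apply: mw => //; apply: measurableC; exact: measurable_set1.
    by rewrite -restrict_EFin; apply/(integrable_mkcond _ mD).
  - by apply: measurableC; exact: measurable_set1.
congr fine; rewrite (pushE _ _ mD1 iu) (pushE _ _ mD2 iv).
have mu1 := mw0 _ _ mD1 iu; have mv2 := mw0 _ _ mD2 iv.
apply: eq_measure_integral => C mC C0.
(* [C] avoids 0, the value of the extension outside [D], so its preimage lies in [D]. *)
have preE D (w : T -> R) : (w \_ D) @^-1` C = D `&` w @^-1` C.
  apply/seteqP; split => x /=; rewrite patchE; case: ifPn => [/set_mem Dx|/negP Dx] //.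
  - by move=> /C0 /(_ erefl).
  - by move=> [].
  - by move=> [/mem_set].
by rewrite /= /pushforward !preE uv.
Qed.

(** * Integrals along an arc as sums over edges *)

Lemma edom_interiorW (R : realType) (e : edge R) : edom_interior e `<=` edom e.
Proof.
rewrite /edom_interior /edom; case: (eshape e) => [l|||l] s //=;
  by rewrite !in_itv /=; lra.
Qed.

Lemma edomD_endpoint (R : realType) (e : edge R) (s : R) :
  edom e s -> ~ edom_interior e s -> eendpoints e (epath e s).
Proof.
rewrite /edom_interior /edom /eendpoints; case: (eshape e) => [l|||l] //=.
  rewrite !in_itv /= => /andP[s0 sl] sI.
  have [->|sn0] := eqVneq s 0; first by left.
  have [->|snl] := eqVneq s l; first by right.
  by exfalso; apply: sI; rewrite !lt_neqAle s0 sl (eq_sym 0) sn0 snl.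
rewrite !in_itv /= !andbT => s0 sI.
have [->//|sn0] := eqVneq s 0.
by exfalso; apply: sI; rewrite !lt_neqAle s0 (eq_sym 0) sn0.
Qed.

Lemma countable_edomD (R : realType) (e : edge R) :
  countable (edom e `\` edom_interior e).
Proof.
apply: finite_set_countable.
rewrite /edom_interior /edom; case: (eshape e) => [l|||l].
- apply: (@sub_finite_set _ _ [set 0; l]); last exact: finite_set2.
  move=> s /=; rewrite !in_itv /= => -[/andP[s0 sl] sI].
  have [->|sn0] := eqVneq s 0; first by left.
  have [->|snl] := eqVneq s l; first by right.
  by exfalso; apply: sI; rewrite !lt_neqAle s0 sl (eq_sym 0) sn0 snl.
- apply: (@sub_finite_set _ _ [set 0]); last exact: finite_set1.
  move=> s /=; rewrite !in_itv /= !andbT => -[s0 sI].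
  have [->//|sn0] := eqVneq s 0.
  by exfalso; apply: sI; rewrite !lt_neqAle s0 (eq_sym 0) sn0.
- by rewrite setDv; exact: finite_set0.
- by rewrite setDv; exact: finite_set0.
Qed.

Lemma measurable_edom (R : realType) (e : edge R) : measurable (edom e).
Proof. by rewrite /edom; case: (eshape e) => [l|||l] //=. Qed.

Lemma measurable_edom_interior (R : realType) (e : edge R) :
  measurable (edom_interior e).
Proof. by rewrite /edom_interior; case: (eshape e) => [l|||l] //=. Qed.

Lemma smooth_edge_continuous (R : realType) (e : edge R) (s : R) :
  smooth_edge e -> edom e s -> {for s, continuous (epath e)}.
Proof. by move=> [_ es _ _] /es; exact: smooth_curve_continuous. Qed.

Lemma unit_speed_edge (R : realType) (e : edge R) :
  smooth_edge e -> unit_speed_on (epath e) (edom_interior e).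
Proof. by move=> [_ es e1 _] s /edom_interiorW es'; split; [exact: es|exact: e1]. Qed.

(** The interior of an edge need not be closed in the plane, but it is a countable union of compact
    arcs. *)
Lemma measurable_preimage_einterior (R : realType) (c : R -> plane R)
    (D : set R) (e : edge R) : measurable D ->
  (forall s, D s -> {for s, continuous c}) -> smooth_edge e ->
  measurable (D `&` c @^-1` einterior e).
Proof.
move=> mD cD he; have [p [q [_ pqE]]] := edom_interior_exhaustion e.
rewrite (_ : _ `&` _ =
    \bigcup_n (D `&` c @^-1` (epath e @` `[p n, q n]%classic))).
  apply: bigcupT_measurable => n; apply: measurable_preimage_closed => //.
  apply: unit_speed_closed_image => s sn; apply: unit_speed_edge => //.
  by rewrite pqE; exists n.
rewrite -setI_bigcupr; congr (_ `&` _).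
rewrite /einterior pqE; apply/seteqP; split=> [s [u [n _ un] us]|s [n _ [u un us]]].
  by exists n => //; exists u.
by exists u => //; exists n.
Qed.

(** Up to the endpoints, a null set of parameters, [g] has the same distribution along the part of
    the arc inside the edge and along the part of the edge inside the arc; on the rest of the edge
    it vanishes. *)
Lemma edge_arc_integral (R : realType) (c : R -> plane R) (a b M : R)
    (e : edge R) (g : plane R -> R) :
  unit_speed_on c `[a, b] -> {in `[a, b] &, injective c} -> smooth_edge e ->
  (forall p, `|g p| <= M) ->
  measurable_fun `[a, b] (g \o c) -> measurable_fun (edom e) (g \o epath e) ->
  (forall s, edom e s -> ~ (c @` `[a, b]) (epath e s) -> g (epath e s) = 0) ->
  \int[lebesgue_measure]_(t in `[a, b] `&` c @^-1` einterior e) g (c t) =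
  \int[lebesgue_measure]_(s in edom e) g (epath e s).
Proof.
move=> u i he gM mgc mge g0.
have [p [q [pq pqE]]] := edom_interior_exhaustion e.
have ue := unit_speed_edge he.
have ie : {in edom_interior e &, injective (epath e)} by case: he.
have mI := measurable_edom_interior e.
have mE := measurable_edom e.
have cc s : `[a, b]%classic s -> {for s, continuous c}.
  by move=> /u[cs _]; exact: smooth_curve_continuous.
have ce s : edom e s -> {for s, continuous (epath e)}.
  exact: smooth_edge_continuous.
pose P := epath e @^-1` (c @` `[a, b]).
rewrite [RHS](_ : _ = \int[lebesgue_measure]_(s in edom e `&` P) g (epath e s)); last first.
  exact: Rintegral_restrict.
have mA : measurable (`[a, b] `&` c @^-1` einterior e).
  exact: measurable_preimage_einterior.
have closed_c : closed (c @` `[a, b]) by exact: unit_speed_closed_image.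
have mEP : measurable (edom e `&` P) by exact: measurable_preimage_closed.
have mIP : measurable (edom_interior e `&` P).
  by apply: measurable_preimage_closed => // s /edom_interiorW; exact: ce.
pose N := edom e `\` edom_interior e.
have cN : countable N by exact: countable_edomD.
have mN : measurable N by exact: measurableD.
have N0 : lebesgue_measure N = 0%E by exact: countable_lebesgue_measure0.
have tr E : measurable (`[a, b] `&` c @^-1` E) ->
    measurable (edom_interior e `&` epath e @^-1` E) ->
    lebesgue_measure (`[a, b] `&` c @^-1` (E `&` einterior e)) =
    lebesgue_measure (edom_interior e `&` epath e @^-1` (E `&` c @` `[a, b])).
  exact: (unit_speed_measure_transfer u i ue ie pq pqE).
have abfin : (lebesgue_measure `[a, b]%classic < +oo :> \bar R)%E.
  by rewrite lebesgue_measure_itv /=; case: ifP; rewrite ?ltry// -EFinB ltry.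
have Afin : (lebesgue_measure (`[a, b] `&` c @^-1` einterior e) < +oo)%E.
  by apply: (@le_lt_trans _ _ _ _ _ _ abfin); exact: lebesgue_outer_le.
(* The edge may have infinite length; finiteness of its part on the arc is transferred from the
   bounded interval [[a, b]]. *)
have IPfin : (lebesgue_measure (edom_interior e `&` P) < +oo)%E.
  have := tr setT; rewrite !setTI => <- //; first by rewrite preimage_setT setIT.
  by rewrite preimage_setT setIT.
have EPN : edom e `&` P `<=` (edom_interior e `&` P) `|` N.
  by move=> s [es Ps]; have [si|si] := pselect (edom_interior e s); [left|right].
have EPfin : (lebesgue_measure (edom e `&` P) < +oo)%E.
  apply: (le_lt_trans (lebesgue_outer_le EPN)).
  by apply: (le_lt_trans (lebesgue_outerU2 _ _)); rewrite N0 adde0.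
have iA : lebesgue_measure.-integrable (`[a, b] `&` c @^-1` einterior e)
    (EFin \o (g \o c)).
  apply: (@bounded_integrable _ _ _ _ _ _ M) => //; last by move=> x _; exact: gM.
  by apply: measurable_funS mgc => //; exact: subIsetl.
have iEP : lebesgue_measure.-integrable (edom e `&` P) (EFin \o (g \o epath e)).
  apply: (@bounded_integrable _ _ _ _ _ _ M) => //; last by move=> x _; exact: gM.
  by apply: measurable_funS mge => //; exact: subIsetl.
have EPI : (edom e `&` P) `\` N = edom_interior e `&` P.
  apply/seteqP; split => s.
    move=> [[es Ps] Ns]; split => //; apply: contrapT => sI.
    by apply: Ns.
  by move=> [si Ps]; split => [|[]//]; split => //; exact: edom_interiorW.
have -> : \int[lebesgue_measure]_(s in edom e `&` P) g (epath e s) =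
    \int[lebesgue_measure]_(s in edom_interior e `&` P) g (epath e s).
  by rewrite -EPI; exact: (@Rintegral_negligible _ _ _ lebesgue_measure _ _ (g \o epath e) mN mEP iEP N0).
apply: (@eq_distribution_Rintegral _ _ _ lebesgue_measure _ _ (g \o c) (g \o epath e)) => //.
  by apply: (@integrableS _ _ _ lebesgue_measure (edom e `&` P)) => //; apply: setSI; exact: edom_interiorW.
move=> C mC.
have mgC D (w : R -> plane R) : measurable D -> measurable_fun D (g \o w) ->
    measurable (D `&` w @^-1` (g @^-1` C)).
  by move=> mD mw; exact: mw.
have E1 : (`[a, b] `&` c @^-1` einterior e) `&` (g \o c) @^-1` C =
    `[a, b] `&` c @^-1` (g @^-1` C `&` einterior e).
  by apply/seteqP; split => s /=; tauto.
have E2 : (edom_interior e `&` P) `&` (g \o epath e) @^-1` C =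
    edom_interior e `&` epath e @^-1` (g @^-1` C `&` c @` `[a, b]).
  by apply/seteqP; split => s; rewrite /P /=; tauto.
(* Here [E] is the preimage of [C] under [g]. *)
rewrite E1 E2; apply: tr; apply: mgC => //.
exact: measurable_funS mE (@edom_interiorW _ e) mge.
Qed.

Lemma countable_preimage (T U : Type) (A : set T) (V : set U) (c : T -> U) :
  {in A &, injective c} -> countable V -> countable (A `&` c @^-1` V).
Proof.
move=> ci /countable_injP[f fi]; apply/countable_injP; exists (f \o c).
move=> s t /set_mem[As Vs] /set_mem[At Vt] /= fst.
by apply: ci; [exact/mem_set|exact/mem_set|apply: fi => //; exact/mem_set].
Qed.

Lemma gpoints_einterior (R : realType) (G : graph R) (p : plane R) :
  smooth_graph G -> gpoints G p -> ~ gverts G p ->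
  exists2 k, gedges G k & einterior (gedge G k) p.
Proof.
move=> [_ [[endG _ _] _]] [//|[k Gk [s es sp]]] pv; exists k => //.
exists s => //; apply: contrapT => sI; apply: pv; rewrite -sp.
by apply: (endG _ Gk); exact: edomD_endpoint.
Qed.

(** The arc is cut into its pieces inside the disjoint interiors of the edges. Only parameters of
    vertices are left over, and injectivity of [c] makes them countable. *)
Lemma graph_arc_integral (R : realType) (G : graph R) (c : R -> plane R)
    (a b M : R) (g : plane R -> R) (F : seq nat) :
  smooth_graph G -> unit_speed_on c `[a, b] -> {in `[a, b] &, injective c} ->
  c @` `[a, b] `<=` gpoints G -> (forall p, `|g p| <= M) ->
  measurable_fun `[a, b] (g \o c) ->
  (forall k, gedges G k -> measurable_fun (edom (gedge G k)) (g \o epath (gedge G k))) ->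
  (forall p, gpoints G p -> ~ (c @` `[a, b]) p -> g p = 0) ->
  uniq F -> (forall k, k \in F -> gedges G k) ->
  (forall k p, gedges G k -> k \notin F -> epoints (gedge G k) p -> g p = 0) ->
  \int[lebesgue_measure]_(t in `[a, b]) g (c t) =
  \sum_(k <- F) \int[lebesgue_measure]_(s in edom (gedge G k)) g (epath (gedge G k) s).
Proof.
move=> hG u i cG gM mgc mge g0 uF FG gF.
have [[_ cV eG] [[_ disjG _] _]] := hG.
have cc s : `[a, b]%classic s -> {for s, continuous c}.
  by move=> /u[cs _]; exact: smooth_curve_continuous.
have mab : measurable (`[a, b]%classic : set R) by [].
pose A k := `[a, b] `&` c @^-1` einterior (gedge G k).
have mA k : gedges G k -> measurable (A k).
  by move=> /eG; exact: measurable_preimage_einterior.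
have abfin : (lebesgue_measure (`[a, b]%classic : set R) < +oo)%E.
  by rewrite lebesgue_measure_itv /=; case: ifP; rewrite ?ltry// -EFinB ltry.
have igc : lebesgue_measure.-integrable `[a, b] (EFin \o (g \o c)).
  by apply: (@bounded_integrable _ _ _ _ _ _ M) => // x _; exact: gM.
have iA k : gedges G k ->
    lebesgue_measure.-integrable `[a, b] (EFin \o ((g \o c) \_ (A k))).
  move=> Gk; rewrite -restrict_EFin.
  apply/integrable_restrict => //; first exact: mA.
  apply: (@integrableS _ _ _ lebesgue_measure `[a, b]) => //.
  by apply: measurableI => //; exact: mA.
pose N := `[a, b] `&` c @^-1` gverts G.
have cN : countable N.
  apply: countable_preimage => // s t /set_mem sab /set_mem tab; exact: i.
have mN : measurable N by exact: countable_measurableR.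
have N0 : lebesgue_measure N = 0%E by exact: countable_lebesgue_measure0.
transitivity (\int[lebesgue_measure]_(t in `[a, b])
    (\sum_(k <- F) ((g \o c) \_ (A k)) t)).
  rewrite (@Rintegral_negligible _ _ _ lebesgue_measure _ _ (g \o c) mN)//.
  rewrite [RHS](@Rintegral_negligible _ _ _ lebesgue_measure _ N)//; last first.
    by apply: integrable_Rsum => // k /FG; exact: iA.
  apply: eq_Rintegral => t /set_mem[tab tN] /=.
  have cG' : gpoints G (c t) by apply: cG; exists t.
  have [|k0 Gk0 k0t] := gpoints_einterior hG cG'.
    by move=> vt; apply: tN.
  have [k0F|k0F] := boolP (k0 \in F).
    rewrite (bigD1_seq k0)//= patchE mem_set//= big_seq_cond big1 ?addr0//.
    move=> k /andP[/FG Gk kk0]; rewrite patchE memNset// => -[_ kt].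
    have : set0 (c t) by rewrite -(disjG _ _ Gk Gk0)//; exact/eqP.
    by [].
  (* On an edge outside [F] the integrand vanishes, so its piece may be missing from the sum. *)
  have ct0 : g (c t) = 0.
    apply: (gF _ _ Gk0 k0F); move: k0t => [s sI <-]; exists s => //.
    exact: edom_interiorW.
  by rewrite ct0 big1// => k _; rewrite patchE; case: ifP.
rewrite Rintegral_sum//; last by move=> k /FG; exact: iA.
apply: eq_big_seq => k /FG Gk.
rewrite -Rintegral_mkcondr setIA setIid; apply: (@edge_arc_integral _ _ _ _ M) => //.
- exact: (eG k Gk).
- exact: (mge k Gk).
- move=> s es; apply: g0; right; exists k => //; by exists s.
Qed.

(** * Geometry of the tube along an arc *)

(* At an endpoint of [a, b] only the one-sided limit of the difference quotient
   is known. *)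
Lemma derive_const_itv (R : realType) (f : R -> R) (a b s l : R) : a < b ->
  s \in `[a, b] -> (forall t, t \in `[a, b] -> f t = 0) ->
  is_derive s 1 f l -> l = 0.
Proof.
move=> ab sab f0 [df <-].
pose q h := h^-1 *: (f (h *: (1 : R) + s) - f s).
have cf : q h @[h --> 0^'] --> 'D_1 f s by exact: df.
rewrite /q (f0 s)// in cf; move: sab; rewrite in_itv /= => /andP[as_ sb].
have [sb'|bs] := ltP s b.
  move/cvg_dnbhs_at_right: cf => cf.
  apply: (cvg_unique (@Rhausdorff R) cf); apply: (@cvg_near_cst _ R); near=> h.
  rewrite f0 ?subrr ?scaler0// in_itv /= -[h *: 1]/(h * 1) mulr1.
  have : 0 < h by near: h; exact: nbhs_right_gt.
  have : h < b - s by near: h; apply: nbhs_right_lt; lra.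
  lra.
move/cvg_dnbhs_at_left: cf => cf.
apply: (cvg_unique (@Rhausdorff R) cf); apply: (@cvg_near_cst _ R); near=> h.
rewrite f0 ?subrr ?scaler0// in_itv /= -[h *: 1]/(h * 1) mulr1.
have : h < 0 by near: h; exact: nbhs_left_lt.
have : a - s < h by near: h; apply: nbhs_left_gt; lra.
lra.
Unshelve. all: by end_near. Qed.

Lemma is_derive_ray (R : realType) (p n : plane R) :
  derivable (fun r : R => p + r *: n) 0 1 /\
  derive1 (fun r : R => p + r *: n) 0 = n.
Proof.
have H : is_diff (0 : R) (fun r : R => p + r *: n) (fun r : R => 0 + r *: n).
  by apply: (@is_diffD _ _ _ (cst p) (fun r : R => r *: n)).
split; first by apply/derivable1_diffP; exact: ex_diff.
rewrite derive1E'; last exact: ex_diff.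
by rewrite diff_val add0r scale1r.
Qed.

(** Lagrange's identity; the square spares a choice of orientation for the frame. *)
Lemma orthonormal_det (R : realType) (n v : plane R) : enorm n = 1 ->
  enorm v = 1 -> dotp n v = 0 -> (n.1 * v.2 - n.2 * v.1) ^+ 2 = 1.
Proof.
move=> /(congr1 (fun x => x ^+ 2)); rewrite sqr_enorm expr1n => nn.
move=> /(congr1 (fun x => x ^+ 2)); rewrite sqr_enorm expr1n => vv nv.
have -> : (n.1 * v.2 - n.2 * v.1) ^+ 2 = dotp n n * dotp v v - dotp n v ^+ 2.
  by rewrite /dotp; ring.
by rewrite nn vv nv; ring.
Qed.

(** In the plane a vector orthogonal to [v] is a multiple of [n], so its length is [dotp g n] up to
    sign, and positivity settles the sign. *)
Lemma orthonormal_enorm (R : realType) (n v g : plane R) : enorm n = 1 ->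
  enorm v = 1 -> dotp n v = 0 -> dotp g v = 0 -> 0 < dotp g n ->
  enorm g = dotp g n.
Proof.
move=> n1 v1 nv gv gn; have J := orthonormal_det n1 v1 nv.
have nn : dotp n n = 1 by rewrite -sqr_enorm n1 expr1n.
(* [v] is [n] turned by a right angle, times the determinant of the frame, which is 1 or -1. *)
have vE : v.1 = - n.2 * (n.1 * v.2 - n.2 * v.1) /\
          v.2 = n.1 * (n.1 * v.2 - n.2 * v.1).
  split.
    transitivity (dotp n n * v.1 - n.1 * dotp n v); first by rewrite nn nv; ring.
    by rewrite /dotp; ring.
  transitivity (dotp n n * v.2 - n.2 * dotp n v); first by rewrite nn nv; ring.
  by rewrite /dotp; ring.
(* Times the nonzero determinant, this component of [g] orthogonal to [n] is [dotp g v]. *)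
have g0 : g.2 * n.1 - g.1 * n.2 = 0.
  have : (g.2 * n.1 - g.1 * n.2) * (n.1 * v.2 - n.2 * v.1) = 0.
    transitivity (g.1 * (- n.2 * (n.1 * v.2 - n.2 * v.1)) +
      g.2 * (n.1 * (n.1 * v.2 - n.2 * v.1))); first by ring.
    by rewrite -vE.1 -vE.2.
  move/eqP; rewrite mulf_eq0 => /orP[/eqP//|/eqP J0].
  by move: J; rewrite J0 expr0n /= => /eqP; rewrite eq_sym oner_eq0.
rewrite /enorm (_ : dotp g g = dotp g n ^+ 2) ?sqrtr_sqr ?gtr0_norm//.
transitivity (dotp g g * dotp n n); first by rewrite nn mulr1.
transitivity (dotp g n ^+ 2 + (g.2 * n.1 - g.1 * n.2) ^+ 2); first by rewrite /dotp; ring.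
by rewrite g0 expr0n addr0.
Qed.

Section tube.
Variables (R : realType) (S : set (plane R)) (phi : plane R -> R) (T : tube R).
Hypothesis hphi : level_set_function S phi.
Hypothesis hT : admissible_arc S T.
Hypothesis hn : unit_normal_to_positive_side phi T.
Hypothesis hw : tube_coordinates S phi T.

Lemma tube_map0 s : tube_map T 0 s = t_path T s.
Proof. by rewrite /tube_map scale0r addr0. Qed.

(** At [r = 0] the derivative of the normal drops out, and the columns of the Jacobian matrix are
    the unit normal and the unit tangent. *)
Lemma tube_jacobian0 s : s \in `[t_start T, t_end T] ->
  tube_jacobian T 0 s = 1.
Proof.
move=> sT; have [_ n1 nv _] := hn sT; have [_ _ _ /(_ s sT)[_ v1]] := hT.
have := orthonormal_det n1 v1 nv.
rewrite /tube_jacobian /tube_map (is_derive_ray _ _).2.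
rewrite (_ : (fun s' => _) = t_path T); last first.
  by apply/funext => s'; rewrite scale0r addr0.
by move=> J; apply/eqP; rewrite -sqrp_eq1// real_normK ?num_real// J.
Qed.

Lemma phi_tube0 s : s \in `[t_start T, t_end T] -> phi (t_path T s) = 0.
Proof.
move=> sT; have [_ TS _ _] := hT; have [SE _] := hphi.
by have [] : (S `\` singular_points S) (t_path T s); [apply: TS; exists s|rewrite {1}SE].
Qed.

(** Whatever solution [xget] picks is 0: where [phi] vanishes so does its sign, hence the signed
    distance, which equals [r] in the tube. *)
Lemma rho_of_phi0 s : s \in `[t_start T, t_end T] -> rho_of_phi phi T 0 s = 0.
Proof.
move=> sT; have [w0 _ wT] := hw; rewrite /rho_of_phi.
have : exists r, [set r | `|r| < t_width T /\ phi (tube_map T r s) = 0] r.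
  by exists 0; rewrite /= normr0 tube_map0 phi_tube0.
move=> /(xgetPex 0) /=; set r := xget _ _ => -[rw phi0].
have [_ + _ _] := wT r s rw sT.
by rewrite /signed_distance phi0 sgr0 mul0r.
Qed.

(** Since [phi] vanishes along the arc, its gradient has no tangential component, and its norm is
    the normal derivative, which is positive in the tube. *)
Lemma enorm_grad_phi s : s \in `[t_start T, t_end T] ->
  enorm (grad phi (t_path T s)) = dphi_drho phi T 0 s /\
  dphi_drho phi T 0 s != 0.
Proof.
move=> sT; have [w0 _ wT] := hw.
have [|_ _ sphi dpos] := wT 0 s _ sT; first by rewrite normr0.
split; last by rewrite gt_eqF.
rewrite tube_map0 in sphi.
have dphi := smooth_near_differentiable sphi.
have [_ n1 nv _] := hn sT; have [ab _ _ /(_ s sT)[sx v1]] := hT.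
have dE : dphi_drho phi T 0 s = dotp (grad phi (t_path T s)) (t_normal T s).
  have [dr rE] := is_derive_ray (t_path T s) (t_normal T s).
  have dphi' : differentiable phi (t_path T s + 0 *: t_normal T s).
    by rewrite scale0r addr0.
  have := is_derive_comp_curve dr dphi'; rewrite rE scale0r addr0 diff_planeE//.
  by move=> H; rewrite /dphi_drho derive1E; exact: derive_val.
rewrite dE; apply: (orthonormal_enorm n1 v1 nv); last by rewrite -dE.
have := is_derive_comp_curve (smooth_curve_derivable sx) dphi.
rewrite diff_planeE//; apply: derive_const_itv ab sT _ => t tT /=.
exact: phi_tube0.
Qed.

End tube.

(** * Reduction of the localized sums to edge integrals *)

Lemma test_function_continuous (R : realType) (f : plane R -> R) :
  test_function f -> continuous f.
Proof.
by move=> [sf _] p; apply/differentiable_continuous/smooth_near_differentiable.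
Qed.

Lemma tsuppP (R : realType) (f : plane R -> R) (p : plane R) :
  ~ tsupp f p -> f p = 0.
Proof.
move=> fp; apply: contrapT => /eqP f0; apply: fp.
exact: subset_closure.
Qed.

Lemma test_function_bounded (R : realType) (f : plane R -> R) :
  test_function f -> exists M, forall p, `|f p| <= M.
Proof.
move=> hf; have cf := test_function_continuous hf; have [_ Kf] := hf.
have [M [_ HM]] : bounded_set (f @` tsupp f).
  apply: compact_bounded; apply: continuous_compact => //.
  exact: continuous_subspaceT.
(* Every number above [M] is a bound on the support; the absolute value makes it nonnegative, as
   needed off the support. *)
exists (`|M| + 1) => p; have [fp|/tsuppP ->] := pselect (tsupp f p).
  by apply: (HM (`|M| + 1)); [rewrite ltr_pwDr// ler_norm|exists p].
by rewrite normr0 addr_ge0.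
Qed.

Lemma measurable_indic_curve (R : realType) (c : R -> plane R) (D : set R)
    (U : set (plane R)) : measurable D -> (forall s, D s -> {for s, continuous c}) ->
  open U -> measurable_fun D (fun s => \1_(~` U) (c s) : R).
Proof.
move=> mD cD oU.
have mU : measurable (D `&` c @^-1` (~` U)).
  by apply: measurable_preimage_closed => //; exact: open_closedC.
have H : {in D, \1_(D `&` c @^-1` (~` U)) =1 (fun s => \1_(~` U) (c s) : R)}.
  move=> s /set_mem Ds; rewrite !indicE; congr (_%:R : R); congr nat_of_bool.
  by apply/idP/idP => /set_mem H; apply/mem_set; [case: H|split].
have mI : measurable_fun D (\1_(D `&` c @^-1` (~` U)) : R -> R) by exact: measurable_indic.

by apply: eq_measurable_fun mI.
Qed.

Lemma indic_le1 (R : realType) (T : Type) (A : set T) (x : T) :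
  `|\1_A x : R| <= 1.
Proof. by rewrite indicE; case: (x \in A); rewrite ?normr1 ?normr0. Qed.

(** The last clause of [smooth_graph] enters here: even an edge of infinite length has finite length
    inside [K]. *)
Lemma integrable_edge (R : realType) (G : graph R) (k : nat) (M : R)
    (K : set (plane R)) (g : plane R -> R) : smooth_graph G -> gedges G k ->
  compact K -> (forall p, `|g p| <= M) -> (forall p, ~ K p -> g p = 0) ->
  measurable_fun (edom (gedge G k)) (g \o epath (gedge G k)) ->
  lebesgue_measure.-integrable (edom (gedge G k)) (EFin \o (g \o epath (gedge G k))).
Proof.
move=> [[_ _ eG] [_ [_ _ finG]]] Gk cK gM gK mg.
have mE := measurable_edom (gedge G k).
pose P := edom (gedge G k) `&` epath (gedge G k) @^-1` K.
have mP : measurable P.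
  apply: measurable_preimage_closed => //.
    by move=> s; apply: smooth_edge_continuous; exact: (eG k Gk).
  by apply: compact_closed => //; exact: norm_hausdorff.
have PE : edom (gedge G k) `&` P = P by rewrite setIA setIid.
apply: (@eq_integrable _ _ _ lebesgue_measure _ mE
  ((EFin \o (g \o epath (gedge G k))) \_ P)).
  move=> s /set_mem es; rewrite patchE; case: ifPn => // /negP Ps.
  rewrite /= gK// => Ks; apply: Ps; exact/mem_set.
apply/integrable_restrict => //; rewrite PE.
apply: (@bounded_integrable _ _ _ _ _ _ M) => //.
- exact: finG.
- by apply: measurable_funS mg => //; exact: subIsetl.
- by move=> s _; exact: gM.
Qed.

Section localized_sums.
Variables (R : realType) (G : graph R) (phi f : plane R -> R) (eps : R).
Variable C : localization R.
Hypothesis hG : smooth_graph G.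
Hypothesis hphi : level_set_function (gpoints G) phi.
Hypothesis hf : test_function f.
Hypothesis hC : admissible (gpoints G) phi f eps C.

Let S := gpoints G.
Let U := l_excised S C.
Let g (i : 'I_(l_size C)) (p : plane R) : R :=
  \1_(~` U) p * f p * l_cutoff i p.

Lemma delta_rho_sumE : delta_rho_sum S f C =
  \sum_(i < l_size C) \int[@lebesgue_measure R]_(s in
    `[t_start (l_tube i), t_end (l_tube i)]) g i (t_path (l_tube i) s).
Proof.
have [_ hT _ _] := hC; apply: eq_bigr => i _; have [aT nT tT] := hT i.
apply: eq_Rintegral => s /set_mem sT.
by rewrite /delta_integral /= (tube_jacobian0 aT nT sT) mulr1 tube_map0.
Qed.

(** At [t = 0] the point is on the arc, where the norm of the gradient cancels against the inverse
    of the normal derivative. *)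
Lemma delta_phi_sumE : delta_phi_sum S phi f C =
  \sum_(i < l_size C) \int[@lebesgue_measure R]_(s in
    `[t_start (l_tube i), t_end (l_tube i)]) g i (t_path (l_tube i) s).
Proof.
have [_ hT _ _] := hC; apply: eq_bigr => i _; have [aT nT tT] := hT i.
apply: eq_Rintegral => s /set_mem sT.
rewrite /delta_integral (rho_of_phi0 hphi aT tT sT) /= (tube_jacobian0 aT nT sT).
have [gE g0] := enorm_grad_phi hphi aT nT tT sT.
by rewrite mulr1 tube_map0 gE mulfK.
Qed.

Lemma open_excised : open U.
Proof.
have [[hU _ _ _] _ _ _] := hC.
by apply: bigcup_open => p /hU[].
Qed.

(** Each arc integral is spread over the edges; after the sums are exchanged, the cut-off functions
    add up to 1 wherever the other factors are nonzero, and the arcs disappear. *)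
Lemma localized_sumE (F : seq nat) : uniq F -> (forall k, k \in F -> gedges G k) ->
  (forall k p, gedges G k -> k \notin F -> epoints (gedge G k) p -> f p = 0) ->
  \sum_(i < l_size C) \int[@lebesgue_measure R]_(s in
    `[t_start (l_tube i), t_end (l_tube i)]) g i (t_path (l_tube i) s) =
  \sum_(k <- F) \int[@lebesgue_measure R]_(s in edom (gedge G k))
    (\1_(~` U) (epath (gedge G k) s) * f (epath (gedge G k) s)).
Proof.
move=> uF FG fF; have [_ hT hcut hsum] := hC.
have [[_ _ eG] _] := hG.
have oU := open_excised.
have cf := test_function_continuous hf.
have [M fM] := test_function_bounded hf.
have gM i : exists M', forall p, `|g i p| <= M'.
  have [M' hM'] := test_function_bounded (hcut i).1.
  exists (M * M') => p; rewrite /g !normrM ler_pM ?mulr_ge0//.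
  by rewrite -[leRHS]mul1r ler_pM// indic_le1.
have mg i c (D : set R) : measurable D -> (forall s, D s -> {for s, continuous c}) ->
    measurable_fun D (g i \o c).
  move=> mD cD; apply: measurable_funM; last first.
    by apply: measurable_fun_comp_curve => //; exact: test_function_continuous (hcut i).1.
  apply: measurable_funM; last exact: measurable_fun_comp_curve.
  exact: measurable_indic_curve.
have mge i k : gedges G k -> measurable_fun (edom (gedge G k)) (g i \o epath (gedge G k)).
  move=> Gk; apply: mg; first exact: measurable_edom.
  by move=> s; apply: smooth_edge_continuous; exact: (eG k Gk).
transitivity (\sum_(i < l_size C) \sum_(k <- F) \int[@lebesgue_measure R]_(s in edom (gedge G k))
    g i (epath (gedge G k) s)).
  apply: eq_bigr => i _; have [[ab TS Ti Tu] _ _] := hT i; have [M' hM'] := gM i.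
  apply: (graph_arc_integral hG _ _ _ hM') => //.
  - by move=> p Tp; have [] := TS p Tp.
  - by apply: mg => // s /Tu[sx _]; exact: smooth_curve_continuous.
  - by move=> k Gk; exact: mge.
  (* Within the graph, a cut-off function is supported on its own arc. *)
  - move=> p Sp Tp; rewrite /g (@tsuppP _ (l_cutoff i)) ?mulr0//.
    by move=> hp; apply: Tp; apply: (hcut i).2.
  - by move=> k p Gk kF kp; rewrite /g (fF k p) ?mulr0 ?mul0r.
rewrite exchange_big /=; apply: eq_big_seq => k /FG Gk.
rewrite -(@Rintegral_sum _ _ _ lebesgue_measure _ _ _ (fun i => g i \o epath (gedge G k))); last 2 first.
- exact: measurable_edom.
- move=> i _; have [M' hM'] := gM i.
  apply: (integrable_edge hG Gk hf.2 hM') => [p fp|]; last exact: mge.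
  by rewrite /g (tsuppP fp) mulr0 mul0r.
apply: eq_Rintegral => s /set_mem es; rewrite /g /= -big_distrr /=.
set p := epath _ s; have Sp : S p by right; exists k => //; exists s.
have [Up|Up] := pselect (U p).
  by rewrite indicE memNset ?mul0r// => /(_ Up).
have [fp|/tsuppP ->] := pselect (tsupp f p); last by rewrite mulr0 mul0r.
by rewrite (nbhs_singleton (hsum p _)) ?mulr1.
Qed.

End localized_sums.

(** * Singular points and the limit of shrinking excisions *)

(** A chart around a point serves every point of its domain, so the points with a chart form an open
    set. *)
Lemma closed_singular_points (R : realType) (S : set (plane R)) :
  closed S -> closed (singular_points S).
Proof.
move=> cS; rewrite (_ : singular_points S = S `&` ~` embedded_curve_near S) //.
apply: closedI => //; apply: open_closedC; rewrite openE => p [W [W' [F [F' [[oW Wp oW'] H]]]]].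
apply: (@filterS _ _ _ W); last exact: open_nbhs_nbhs.
by move=> q Wq; exists W, W', F, F'.
Qed.

Lemma near_notin_thickening (R : realType) (P : set (plane R)) (q : plane R) :
  closed P -> ~ P q ->
  \forall eps \near 0^'+, ~ exists2 p, P p & enorm (q - p) < eps.
Proof.
move=> cP Pq; have /nbhs_ballP[e /= e0 He] : nbhs q (~` P).
  by apply: open_nbhs_nbhs; split => //; exact: closed_openC.
near=> eps => -[p Pp qp]; apply: (He p) => //.
rewrite -ball_normE /=; apply: le_lt_trans (norm_le_enorm _) _.
by apply: lt_trans qp _; near: eps; exact: nbhs_right_lt.
Unshelve. all: by end_near. Qed.

(** Each neighbourhood contains a point with rational coordinates, and disjointness makes the choice
    of such points injective. *)
Lemma countable_disjoint_open (R : realType) (P : set (plane R))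
    (N : plane R -> set (plane R)) :
  (forall p, P p -> open (N p) /\ N p p) -> trivIset P N -> countable P.
Proof.
move=> oN tN.
have ratN p : P p -> exists r : rat * rat, N p (ratr r.1, ratr r.2).
  move=> /oN[op Np]; have [[A B] /= [nA nB] AB] : nbhs p (N p) by exact: open_nbhs_nbhs.
  have ratI (x : R) D : nbhs x D -> exists r : rat, D (ratr r).
    move=> nD; have [|z [/interior_subset Dz [r _ rE]]] := dense_rat _ (@open_interior _ D).
      by exists x; exact: nD.
    by exists r; rewrite rE.
  have [x Ax] := ratI _ _ nA; have [y By] := ratI _ _ nB.
  by exists (x, y); exact: AB.
have /choice[h hP] : forall p, exists r : rat * rat, P p -> N p (ratr r.1, ratr r.2).
  move=> p; have [/ratN[r Hr]|Pp] := pselect (P p); first by exists r.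
  by exists (0, 0).
apply/countable_injP; exists (pickle \o h) => p q /set_mem Pp /set_mem Pq /=.
move=> /(pcan_inj pickleK) hpq; apply: tN => //.
by exists (ratr (h p).1, ratr (h p).2); split; [exact: hP|rewrite hpq; exact: hP].
Qed.

(** Dominated convergence with bound [|f|]; pointwise convergence can fail only at parameters sent
    into [P], which are countably many. *)
Lemma excised_edge_integral_cvg (R : realType) (G : graph R) (f : plane R -> R)
    (k : nat) (P : set (plane R)) (U : R -> set (plane R)) :
  smooth_graph G -> test_function f -> gedges G k -> closed P -> countable P ->
  (\forall eps \near 0^'+, open (U eps) /\
     U eps `<=` [set q | exists2 p, P p & enorm (q - p) < eps]) ->
  \int[@lebesgue_measure R]_(s in edom (gedge G k))
    (\1_(~` U eps) (epath (gedge G k) s) * f (epath (gedge G k) s))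
    @[eps --> 0^'+] -->
  \int[@lebesgue_measure R]_(s in edom (gedge G k)) f (epath (gedge G k) s).
Proof.
move=> hG hf Gk cP coP hU; set e := gedge G k.
have he : smooth_edge e by move: hG => [[_ _ eG] _]; exact: (eG k Gk).
have mE := measurable_edom e.
have ce s : edom e s -> {for s, continuous (epath e)} by exact: smooth_edge_continuous.
have cf := test_function_continuous hf.
have [M fM] := test_function_bounded hf.
have mfe : measurable_fun (edom e) (f \o epath e) by exact: measurable_fun_comp_curve.
have ife := integrable_edge hG Gk hf.2 fM (@tsuppP _ f) mfe.
move: hU => [e0 /= e00 hU].
have hU' eps : 0 < eps -> eps < e0 -> open (U eps) /\
     U eps `<=` [set q | exists2 p, P p & enorm (q - p) < eps].
  by move=> p0 pe; apply: hU => //=; rewrite sub0r normrN gtr0_norm.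
apply/cvg_at_rightP => u [u0 uc].
(* The hypotheses on [U eps] hold only for [eps < e0], while the dominated
   convergence theorem is about all indices. *)
pose v n := Num.min (u n) (e0 / 2).
have v0 n : 0 < v n by rewrite /v lt_min u0 divr_gt0.
have ve n : v n < e0 by rewrite /v gt_min ltr_pdivrMr ?mulr_natr ?mulr2n ?ltrDl ?e00 ?orbT.
have uv : \forall n \near \oo, v n = u n.
  near=> n; rewrite /v; apply/min_idPl/ltW.
  near: n; apply: (cvgr_lt _ uc); exact: divr_gt0.
have vc : v n @[n --> \oo] --> 0.
  by apply: cvg_trans uc; apply: near_eq_cvg; near=> n; apply/esym; near: n.
pose h n s : R := \1_(~` U (v n)) (epath e s) * f (epath e s).
have mh n : measurable_fun (edom e) (h n).
  apply: measurable_funM mfe; apply: measurable_indic_curve => //.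
  by have [] := hU' _ (v0 n) (ve n).
pose N := edom e `&` epath e @^-1` P.
have cN : countable N.
  (* The edge is known to be injective on the interior of its domain only; the remaining parameters
     are countable anyway. *)
  have -> : N = (edom_interior e `&` epath e @^-1` P) `|` ((edom e `\` edom_interior e) `&` epath e @^-1` P).
    apply/seteqP; split => s.
      by move=> [es Ps]; have [si|si] := pselect (edom_interior e s); [left|right].
    by move=> [[/edom_interiorW]|[[]]].
  rewrite -bigcup2E; apply: bigcup_countable => // -[|[|n]] _ /=; last exact: countable0.
    by apply: countable_preimage => //; case: he.
  apply: sub_countable (countable_edomD e); apply: subset_card_le; exact: subIsetl.
have hcv s : edom e s -> ~ N s -> h n s @[n --> \oo] --> f (epath e s).
  (* As [P] is closed, a point outside it is eventually outside the excised sets, and the sequence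
     is constant from then on. *)
  move=> es Ns; apply: (@cvg_near_cst _ R); rewrite /h.
  have Ps : ~ P (epath e s) by move=> Ps; apply: Ns.
  have Hn : \forall n \near \oo, ~ exists2 p, P p & enorm (epath e s - p) < v n.
    have := near_notin_thickening cP Ps.
    move=> [e1 /= e10 He1].
    near=> n; apply: (He1 (v n)) => //=.
    rewrite sub0r normrN gtr0_norm//; near: n.
    exact: (cvgr_lt _ vc).
  near=> n.
  have [_ UP] := hU' _ (v0 n) (ve n).
  have Hs : ~ (exists2 p, P p & enorm (epath e s - p) < v n) by near: n.
  have Un : (~` U (v n)) (epath e s) by move=> /UP.
  by rewrite indicE (mem_set Un) mul1r.
have DC := @dominated_convergence _ _ _ (@lebesgue_measure R) (edom e) mE
  (fun n => EFin \o h n) (EFin \o (f \o epath e)) (fun s => `|(f (epath e s))%:E|)%E.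
have [||||| _ _ cvI] := DC.
- by move=> n; apply/measurable_EFinP; exact: mh.
- exact/measurable_EFinP.
- exists N; split; first exact: countable_measurableR.
    exact: countable_lebesgue_measure0.
  move=> s /= Hs; apply: contrapT => Ns; apply: Hs => es.
  by apply: cvg_EFin; [exact: nearW|exact: hcv].
- exact: integrable_abse ife.
- apply: aeW => s n es; rewrite /h /= lee_fin normrM ler_piMl//.
  exact: indic_le1.
have cvR : fine \o (fun n => \int[@lebesgue_measure R]_(s in edom e) (h n s)%:E)%E @ \oo -->
    \int[@lebesgue_measure R]_(s in edom e) f (epath e s).
  apply: fine_cvg; rewrite /Rintegral fineK; first exact: cvI.
  exact: (@integrable_fin_num _ _ _ lebesgue_measure _ mE _ ife).
apply: cvg_trans cvR; apply: near_eq_cvg; near=> n.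
have vun : v n = u n by near: n.
by rewrite /= /Rintegral /h vun.
Unshelve. all: by end_near. Qed.

Theorem theorem4 (R : realType) (G : graph R) (phi : plane R -> R)
    (hG : smooth_graph G)
    (hphi : level_set_function (gpoints G) phi)
    (f : plane R -> R) (hf : test_function f)
    (c : R -> localization R)
    (hc : \forall eps \near 0^'+,
       admissible (gpoints G) phi f eps (c eps)) :
  (delta_rho_sum (gpoints G) f (c eps) @[eps --> 0^'+]
     --> arc_length_integral G f) /\
  (delta_phi_sum (gpoints G) phi f (c eps) @[eps --> 0^'+]
     --> arc_length_integral G f).
Proof.
have [[cS _ eG] [_ [_ finG _]]] := hG.
(* Only finitely many edges meet the support of [f]; [F] lists them without repetition. *)
have [_ finK] := finG _ hf.2.
set K := [set k | _ /\ _] in finK.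
have /finite_seqP[F0 KF0] := finK.
pose F := undup F0.
have uF : uniq F by exact: undup_uniq.
have FK k : (k \in F) = (k \in K).
  by rewrite mem_undup KF0; apply/idP/idP => [kF|/set_mem //]; exact/mem_set.
have FG k : k \in F -> gedges G k by rewrite FK => /set_mem[].
have fF k p : gedges G k -> k \notin F -> epoints (gedge G k) p -> f p = 0.
  move=> Gk kF kp; apply: tsuppP => fp; move/negP: kF; apply.
  by rewrite FK; apply/mem_set; split => //; exists p.
pose P := singular_points (gpoints G).
have cP : closed P by exact: closed_singular_points.
have coP : countable P.
  (* A single admissible choice already provides disjoint neighbourhoods of all singular points. *)
  have [eps hCe] : exists eps, admissible (gpoints G) phi f eps (c eps).
    exact: (@filter_ex _ _ (at_right_proper_filter (0 : R)) _ hc).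
  have [[hU tU _ _] _ _ _] := hCe.
  by apply: countable_disjoint_open tU => p /hU[].
have aE : arc_length_integral G f = \sum_(k <- F)
    \int[@lebesgue_measure R]_(s in edom (gedge G k)) f (epath (gedge G k) s).
  rewrite /arc_length_integral (fsbigE F) //.
  - rewrite big_seq_cond [RHS]big_seq; apply: eq_bigl => k.
    by have [/FG/mem_set ->|] := boolP (k \in F).
  - move=> k Gk kF; transitivity (\int[@lebesgue_measure R]_(s in edom (gedge G k)) (0 : R)).
      by apply: eq_Rintegral => s /set_mem es; apply: (fF k) => //; exists s.
    by rewrite Rintegral_cst ?mul0r//; exact: measurable_edom.
have lim : \sum_(k <- F) \int[@lebesgue_measure R]_(s in edom (gedge G k))
    (\1_(~` l_excised (gpoints G) (c eps)) (epath (gedge G k) s) *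
     f (epath (gedge G k) s)) @[eps --> 0^'+] --> arc_length_integral G f.
  rewrite aE big_seq; under eq_cvg do rewrite big_seq.
  apply: cvg_big => [|k /FG Gk]; first exact: add_continuous.
  apply: (excised_edge_integral_cvg hG hf Gk cP coP).
  near=> eps.
  have hCe : admissible (gpoints G) phi f eps (c eps) by near: eps.
  by split; [exact: open_excised hCe|have [[]] := hCe].
(* For small [eps] both sums equal the sum of edge integrals in [lim], hence share its limit. *)
split; apply: cvg_trans lim; apply: near_eq_cvg; near=> eps.
  have hCe : admissible (gpoints G) phi f eps (c eps) by near: eps.
  by rewrite (delta_rho_sumE hCe) (localized_sumE hG hf hCe uF FG fF).
have hCe : admissible (gpoints G) phi f eps (c eps) by near: eps.
by rewrite (delta_phi_sumE hphi hCe) (localized_sumE hG hf hCe uF FG fF).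
Unshelve. all: by end_near. Qed.
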